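(* Let $(\mathcal A,\wedge,\delta,\Delta,[\cdot\bullet\cdot])$ be a DGBV algebra over $\mathbf k$ satisfying the $\delta\Delta$-condition, such that $H=H(\mathcal A,\delta)$ is a free $\mathbf k$-module with free homogeneous generators $e_0=1,e_1,\dots,e_{n-1}$, and equipped with a nice integral $\int$. Then for any two universal normalized solutions $\Gamma$ and $\overline\Gamma$ (for the generators $e_\alpha$), there exists an odd element $A\in(\operatorname{Im}\Delta)[[\mathbf t]]$ with vanishing zeroth order term such that $$e^A\cdot\Gamma=\overline\Gamma.$$ Furthermore, the potential function $\Phi$ is gauge invariant: $\Phi(e^A\cdot\Gamma)=\Phi(\Gamma)$ for every universal normalized solution $\Gamma$ and every odd $A\in(\operatorname{Im}\Delta)[[\mathbf t]]$ with vanishing zeroth order term.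
   Context: Let $\mathbf k$ be a graded commutative associative unital algebra over $\mathbb Q$ and let $(\mathcal A,\wedge)$ be a graded commutative associative algebra with unit $1$ over $\mathbf k$ (only the parity $|a|$ of degrees matters for signs). DGBV algebra: for an odd linear operator $\Delta$ on $\mathcal A$ set $[a\bullet b]=(-1)^{|a|}\big(\Delta(a\wedge b)-(\Delta a)\wedge b-(-1)^{|a|}a\wedge\Delta b\big)$ for homogeneous $a,b$. If $\Delta^2=0$ and $[a\bullet(b\wedge c)]=[a\bullet b]\wedge c+(-1)^{(|a|-1)|b|}b\wedge[a\bullet c]$ for all homogeneous $a,b,c$, then $(\mathcal A,\wedge,\Delta,[\cdot\bullet\cdot])$ is a GBV algebra. A DGBV algebra is a GBV algebra with an odd $\mathbf k$-linear derivation $\delta$ of $\wedge$ such that $\delta^2=\delta\Delta+\Delta\delta=0$. $H(\mathcal A,\delta)=\operatorname{Ker}\delta/\operatorname{Im}\delta$, with the product induced by $\wedge$. $\delta\Delta$-condition: $\operatorname{Im}\delta\Delta=\operatorname{Im}\delta\cap\operatorname{Ker}\Delta=\operatorname{Im}\Delta\cap\operatorname{Ker}\delta$ (equivalently, the inclusions $(\operatorname{Ker}\Delta,\delta)\hookrightarrow(\mathcal A,\delta)$ and $(\operatorname{Ker}\delta,\Delta)\hookrightarrow(\mathcal A,\Delta)$ induce isomorphisms on homology). Integral: a $\mathbf k$-linear map $\int:\mathcal A\to\mathbf k$ with $\int\delta a\wedge b=(-1)^{|a|+1}\int a\wedge\delta b$ and $\int\Delta a\wedge b=(-1)^{|a|}\int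 a\wedge\Delta b$ for homogeneous $a,b$. It induces a bilinear form $g([a],[b])=\int a\wedge b$ on $H$, and is nice if $[a]\mapsto g([a],\cdot)$ is an isomorphism $H\to\operatorname{Hom}_{\mathbf k}(H,\mathbf k)$. Let $t^0,\dots,t^{n-1}$ be the generators of $\operatorname{Hom}_{\mathbf k}(H,\mathbf k)$ dual to $e_0,\dots,e_{n-1}$, where $t^\alpha$ has the parity of $e_\alpha$. $\mathbf k[[\mathbf t]]$ denotes the super (graded commutative) formal power series in the $t^\alpha$, $\mathcal A[[\mathbf t]]$ the super formal power series with coefficients in $\mathcal A$; all operations $\wedge,\delta,\Delta,[\cdot\bullet\cdot],\int$ are extended using the Koszul sign rule. A universal normalized solution is an even $\Gamma=\Gamma_1+\Gamma_2+\cdots\in\mathcal A[[\mathbf t]]$ with $\delta\Gamma+\frac12[\Gamma\bullet\Gamma]=0$, where $\Gamma_1=\sum_\alpha x_\alpha t^\alpha$ with $x_\alpha\in\operatorname{Ker}\Delta\cap\operatorname{Ker}\delta$ representing $e_\alpha$, and for $m>1$, $\Gamma_m$ is homogeneous of order $m$ in the $t^\alpha$ with coefficients in $\operatorname{Im}\Delta$, and $t^0$ appears only in $\Gamma_1$. Gauge action: with $\operatorname{ad}_A=[A\bullet\cdot]$, for odd $A\in\mathcal A[[\mathbf t]]$ with zero zeroth order term and even $\omega\in\mathcal A[[\mathbf t]]$ with zero zeroth order term, $$e^A\cdot\omega=e^{\operatorname{ad}_A}\omega+\frac{1-e^{\operatorname{ad}_A}}{\operatorname{ad}_A}\,\delta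 A=\sum_{q\ge0}\frac1{q!}\operatorname{ad}_A^q\omega-\sum_{q\ge0}\frac1{(q+1)!}\operatorname{ad}_A^q\delta A .$$ Potential: for even $\Gamma\in\mathcal A[[\mathbf t]]$ with zero zeroth order term and first order (linear in the $t^\alpha$) part $\Gamma_1$, $$\Phi(\Gamma)=\int\Big(\tfrac16\Gamma^3-\tfrac14(\Gamma-\Gamma_1)\wedge\Gamma^2\Big)\in\mathbf k[[\mathbf t]].$$ *)

(* Defs.v *)
From HB Require Import structures.
From mathcomp Require Import all_boot all_order all_algebra.
From mathcomp Require Import boolp classical_sets.
From mathcomp Require Import mpoly.

Set Implicit Arguments.
Unset Strict Implicit.
Unset Printing Implicit Defensive.

Import GRing.Theory.

Local Open Scope ring_scope.
Local Open Scope quotient_scope.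

(* Parities are booleans: [false] is even, [true] is odd.  Only parities matter
   for signs, so a grading is recorded modulo 2. *)

(* A direct sum decomposition V = V_0 (+) V_1, given by its two projections. *)
Record grading (V : zmodType) := Grading {
  part : bool -> {additive V -> V};
  part_part : forall p q v, part p (part q v) = if p == q then part q v else 0;
  part_sum : forall v, part false v + part true v = v }.

Definition homogeneous (V : zmodType) (g : grading V) (p : bool) (v : V) : Prop :=
  part g p v = v.

Definition graded_comm (R : nzRingType) (g : grading R) : Prop :=
  [/\ homogeneous g false 1,
      forall p q a b, homogeneous g p a -> homogeneous g q b -> homogeneous g (p (+) q) (a * b)
    & forall p q a b, homogeneous g p a -> homogeneous g q b ->
        a * b = (-1) ^+ (p && q) * (b * a)].

Section Klinear.
Variables (k : nzRingType) (gk : grading k).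

(* k-linear maps of parity p, with the Koszul sign
   f (c v) = (-1)^(p |c|) c (f v); [hV], [hW] are the homogeneity predicates
   of V and W. *)
Definition klinear (V W : lmodType k) (hV : bool -> V -> Prop)
    (hW : bool -> W -> Prop) (p : bool) (f : V -> W) : Prop :=
  [/\ forall u v, f (u + v) = f u + f v,
      forall q v, hV q v -> hW (p (+) q) (f v)
    & forall q c v, homogeneous gk q c -> f (c *: v) = (-1) ^+ (p && q) *: (c *: f v)].

(* The elements of Hom_k(V, W): sums of an even and an odd k-linear map.
   When k is purely even these are all the k-linear maps. *)
Definition khom (V W : lmodType k) (hV : bool -> V -> Prop)
    (hW : bool -> W -> Prop) (f : V -> W) : Prop :=
  exists f0 f1 : V -> W, [/\ klinear hV hW false f0, klinear hV hW true f1
    & forall v, f v = f0 v + f1 v].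

End Klinear.

Section Bracket.
Variables (A : nzRingType) (g : grading A) (D : A -> A).

(* The bracket [a . b] attached to D, extended additively from homogeneous a. *)
Definition bv_bracket (a b : A) : A :=
  \sum_(p : bool) (-1) ^+ p *
    (D (part g p a * b) - D (part g p a) * b - (-1) ^+ p * (part g p a * D b)).

End Bracket.

(* DGBV algebras over the graded commutative ring k; [d] is the differential
   and [D] the BV operator.  With k graded, linearity of the odd operators
   [d], [D] carries the Koszul sign. *)
Record dgbvAlgebra (k : nzRingType) (gk : grading k) := DGBVAlgebra {
  dgbv_sort :> lalgType k;
  gr : grading dgbv_sort;
  d : {additive dgbv_sort -> dgbv_sort};
  D : {additive dgbv_sort -> dgbv_sort};
  gr_comm : graded_comm gr;
  gr_scale : forall p q c a,
    homogeneous gk p c -> homogeneous gr q a -> homogeneous gr (p (+) q) (c *: a);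
  D_odd : klinear gk (homogeneous gr) (homogeneous gr) true D;
  D_sq : forall a, D (D a) = 0;
  bracket_der : forall p q a b c, homogeneous gr p a -> homogeneous gr q b ->
    bv_bracket gr D a (b * c) =
      bv_bracket gr D a b * c +
      (-1) ^+ (~~ p && q) * (b * bv_bracket gr D a c);
  d_odd : klinear gk (homogeneous gr) (homogeneous gr) true d;
  d_der : forall p a b, homogeneous gr p a ->
    d (a * b) = d a * b + (-1) ^+ p * (a * d b);
  d_sq : forall a, d (d a) = 0;
  dD_anti : forall a, d (D a) + D (d a) = 0 }.

Arguments gr {k gk} _.
Arguments d {k gk} _.
Arguments D {k gk} _.

Section Homology.
Variables (k : nzRingType) (gk : grading k) (A : dgbvAlgebra gk).

Definition closed_pred : {pred A} := [pred a | d A a == 0].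

Lemma d_scale0 c (a : A) : d A a = 0 -> d A (c *: a) = 0.
Proof.
move=> da0; have [_ _ dZ] := d_odd A.
have hp p : homogeneous gk p (part gk p c) by rewrite /homogeneous part_part eqxx.
rewrite -(part_sum gk c) scalerDl raddfD /=.
by rewrite (dZ _ _ _ (hp false)) (dZ _ _ _ (hp true)) da0 !scaler0 addr0.
Qed.

Lemma closed_pred_submod : submod_closed closed_pred.
Proof.
split=> [|c a b]; first by rewrite inE raddf0.
rewrite !inE => /eqP da0 /eqP db0.
by rewrite raddfD /= d_scale0 // db0 addr0.
Qed.

HB.instance Definition _ :=
  GRing.isSubmodClosed.Build k A closed_pred closed_pred_submod.

Record cocycle := Cocycle { coc :> A; cocP : coc \in closed_pred }.

HB.instance Definition _ := [isSub for coc].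
HB.instance Definition _ := [Choice of cocycle by <:].
HB.instance Definition _ := [SubChoice_isSubLmodule of cocycle by <:].

Definition exact_pred : {pred cocycle} :=
  fun z => `[< exists b, d A b = coc z >].

Lemma exact_pred_zmod : zmod_closed exact_pred.
Proof.
split=> [|x y]; first by apply/asboolP; exists 0; rewrite raddf0.
move=> /asboolP[b db] /asboolP[c dc]; apply/asboolP; exists (b - c).
by rewrite raddfB /= db dc.
Qed.

HB.instance Definition _ :=
  GRing.isZmodClosed.Build cocycle exact_pred exact_pred_zmod.

Definition homology : Type := {ideal_quot exact_pred}.

HB.instance Definition _ := GRing.Zmodule.on homology.
HB.instance Definition _ := EqQuotient.on homology.

Definition cls (z : cocycle) : homology := \pi_homology z.

Lemma cls_eq (x y : cocycle) : cls x = cls y <-> exists b, d A b = coc x - coc y.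
Proof.
rewrite /cls; have := Quotient.idealrBE exact_pred x y.
move=> E; split=> [/eqP|h].
  by rewrite -E => /asboolP.
by apply/eqP; rewrite -E; apply/asboolP.
Qed.

Lemma clsD : {morph cls : x y / x + y}.
Proof. by move=> x y; rewrite /cls raddfD. Qed.

Lemma cls_repr (u : homology) : cls (repr u) = u.
Proof. exact: reprK. Qed.

Definition hscale (c : k) (u : homology) : homology := cls (c *: repr u).

Lemma hscale_cls c z : hscale c (cls z) = cls (c *: z).
Proof.
have /cls_eq[b db] := cls_repr (cls z).
have [_ _ dZ] := d_odd A.
apply/cls_eq; rewrite -scalerBr /= -db.
exists (part gk false c *: b - part gk true c *: b).
have hp p : homogeneous gk p (part gk p c) by rewrite /homogeneous part_part eqxx.
rewrite raddfB /= (dZ _ _ _ (hp false)) (dZ _ _ _ (hp true)) /=.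
by rewrite expr0 expr1 scale1r scaleN1r opprK -scalerDl part_sum.
Qed.

Lemma hscaleA a b v : hscale a (hscale b v) = hscale (a * b) v.
Proof. by rewrite -(cls_repr v) !hscale_cls scalerA. Qed.

Lemma hscale1 : left_id 1 hscale.
Proof. by move=> v; rewrite -(cls_repr v) hscale_cls scale1r. Qed.

Lemma hscaleDr : right_distributive hscale +%R.
Proof.
move=> c u v; rewrite -(cls_repr u) -(cls_repr v) -clsD !hscale_cls.
by rewrite scalerDr clsD.
Qed.

Lemma hscaleDl v : {morph hscale^~ v : a b / a + b}.
Proof. by move=> a b; rewrite -(cls_repr v) !hscale_cls scalerDl clsD. Qed.

HB.instance Definition _ := GRing.Zmodule_isLmodule.Build k homology
  hscaleA hscale1 hscaleDr hscaleDl.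

Definition represents (a : A) (u : homology) : Prop :=
  exists2 z : cocycle, coc z = a & cls z = u.

Definition homogeneous_cls (p : bool) (u : homology) : Prop :=
  exists2 a : A, homogeneous (gr A) p a & represents a u.

Definition free_basis (I : finType) (e : I -> homology) : Prop :=
  forall u, exists! c : {ffun I -> k}, u = \sum_i c i *: e i.

Definition dD_condition : Prop :=
  range (d A \o D A) = (range (d A) `&` [set a | D A a = 0])%classic /\
  range (d A \o D A) = (range (D A) `&` [set a | d A a = 0])%classic.

(* k^o is k as a module over itself. *)
Definition integral (I : A -> k^o) : Prop :=
  [/\ khom gk (W := k^o) (homogeneous (gr A)) (homogeneous gk) I,
      forall p a b, homogeneous (gr A) p a ->
        I (d A a * b) = (-1) ^+ p.+1 * I (a * d A b)
    & forall p a b, homogeneous (gr A) p a ->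
        I (D A a * b) = (-1) ^+ p * I (a * D A b)].

(* Computed on representatives; independent of their choice by [pairing_cls]. *)
Definition pairing (I : A -> k^o) (u v : homology) : k^o :=
  I (coc (repr u) * coc (repr v)).

Lemma pairing_cls (I : A -> k^o) (x y : cocycle) : integral I ->
  pairing I (cls x) (cls y) = I (coc x * coc y).
Proof.
move=> [[f0 [f1 [[f0D _ _] [f1D _ _] fE]]] Id _].
have ID u v : I (u + v) = I u + I v by rewrite !fE f0D f1D addrACA.
have I0 : I 0 = 0 by apply: (addIr (I 0)); rewrite -ID !add0r.
have IB u v : I (u - v) = I u - I v.
  by apply: (addIr (I v)); rewrite -ID !subrK.
have hp p a : homogeneous (gr A) p (part (gr A) p a).
  by rewrite /homogeneous part_part eqxx.
have dc (z : cocycle) : d A (coc z) = 0 by case: z => z /= /eqP.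
have Idl b (z : cocycle) : I (d A b * coc z) = 0.
  rewrite -(part_sum (gr A) b) raddfD /= mulrDl ID.
  by rewrite (Id _ _ _ (hp false b)) (Id _ _ _ (hp true b)) dc !mulr0 I0 !mulr0 addr0.
have Idr b (z : cocycle) : I (coc z * d A b) = 0.
  have Ih p : I (part (gr A) p (coc z) * d A b) = 0.
    have := Id p _ b (hp p (coc z)).
    suff -> : d A (part (gr A) p (coc z)) = 0.
      rewrite mul0r I0 => /esym; rewrite -signr_odd.
      by case: (odd _); rewrite ?expr0 ?expr1 ?mul1r // mulN1r => /eqP; rewrite oppr_eq0 => /eqP.
    have [_ dh _] := d_odd A.
    have dE : d A (part (gr A) false (coc z)) + d A (part (gr A) true (coc z)) = 0.
      by rewrite -raddfD /= part_sum dc.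
    have h1 := dh _ _ (hp false (coc z)); have h2 := dh _ _ (hp true (coc z)).
    have E q : part (gr A) q (d A (part (gr A) false (coc z)))
             + part (gr A) q (d A (part (gr A) true (coc z))) = 0.
      by rewrite -raddfD dE raddf0.
    have := E (~~ p); rewrite -h1 -h2 !part_part.
    by case: p => /=; rewrite ?add0r ?addr0 ?h1 ?h2.
  by rewrite -(part_sum (gr A) (coc z)) mulrDl ID !Ih addr0.
rewrite /pairing; set x' := repr _; set y' := repr _.
have /cls_eq[b db] : cls x' = cls x := cls_repr _.
have /cls_eq[c ec] : cls y' = cls y := cls_repr _.
apply/eqP; rewrite -subr_eq0 -IB.
have -> : coc x' * coc y' - coc x * coc y = d A b * coc y' + coc x * d A c.
  by rewrite db ec mulrBl mulrBr addrA subrK.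
by rewrite ID Idl Idr addr0.
Qed.

Definition nice (I : A -> k^o) : Prop :=
  forall f : homology -> k^o,
    khom gk (W := k^o) homogeneous_cls (homogeneous gk) f ->
    exists! u, forall v, pairing I u v = f v.

End Homology.

Section Series.
Variables (k : algType rat) (gk : grading k) (A : dgbvAlgebra gk) (n : nat).
(* [eps i] is the parity of the variable t^i. *)
Variable eps : 'I_n -> bool.

(* Super power series in t^0, ..., t^(n-1) are encoded by their coefficients,
   written to the left of the ordered monomials
   t^m = (t^0)^(m 0) (t^1)^(m 1) ...; since t^m = 0 as soon as an odd variable
   has an exponent > 1, the coefficients at such m are required to be 0
   ([superseries]). *)
Definition series (V : Type) := 'X_{1..n} -> V.

Definition admissible (m : 'X_{1..n}) : bool := [forall i, eps i ==> (m i <= 1)%N].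

Definition superseries (V : zmodType) (F : series V) : Prop :=
  forall m, ~~ admissible m -> F m = 0.

Definition mparity (m : 'X_{1..n}) : bool := odd (\sum_(i < n | eps i) m i)%N.

Definition series_parity (p : bool) (F : series A) : Prop :=
  forall m, homogeneous (gr A) (p (+) mparity m) (F m).

Definition coef_in (S : set A) (F : series A) : Prop := forall m, S (F m).

(* t^I t^J = (-1)^(swaps I J) t^(I+J) *)
Definition swaps (I J : 'X_{1..n}) : nat :=
  (\sum_(i < n | eps i) \sum_(j < n | eps j && (j < i)) I i * J j)%N.

(* Koszul extension of a bilinear operation B of parity q to series:
   (x t^I) B (y t^J) = (-1)^(|t^I| (q + |y|)) (x B y) t^I t^J. *)
Definition kext (q : bool) (B : A -> A -> A) (F G : series A) : series A :=
  fun m => if admissible m then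
    \sum_(IJ : 'X_{1..n < (mdeg m).+1, (mdeg m).+1} | m == (IJ.1 + IJ.2)%MM)
      \sum_(r : bool)
        (-1) ^+ swaps IJ.1 IJ.2 * ((-1) ^+ (mparity IJ.1 && (q (+) r)) *
          B (F IJ.1) (part (gr A) r (G IJ.2)))
    else 0.

Definition smul : series A -> series A -> series A := kext false *%R.

(* The bracket is an odd operation, its symbol sitting between the two
   arguments; this extension is also the bracket attached to the extensions
   of D and of the product. *)
Definition sbracket : series A -> series A -> series A :=
  kext true (bv_bracket (gr A) (D A)).

Definition sd (F : series A) : series A := fun m => d A (F m).

Definition qscale (c : rat) (a : A) : A := (c%:A : k) *: a.

(* The t-adically convergent sums defining e^S . w, for S without constant
   term: by [iter_ad_small] only the terms with q <= mdeg m contribute to the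
   coefficient at m. *)
Definition gauge (S w : series A) : series A := fun m =>
  \sum_(q < (mdeg m).+1)
     qscale (q`!%:R)^-1 (iter q (sbracket S) w m)
  - \sum_(q < (mdeg m).+1)
     qscale (q.+1`!%:R)^-1 (iter q (sbracket S) (sd S) m).

Definition first_order (F : series A) : series A :=
  fun m => if mdeg m == 1%N then F m else 0.

Definition potential (I : A -> k^o) (F : series A) : series k^o := fun m =>
  I (qscale (1 / 6) (smul F (smul F F) m)
     - qscale (1 / 4) (smul (fun m' => F m' - first_order F m') (smul F F) m)).

Definition maurer_cartan (F : series A) : Prop :=
  forall m, sd F m + qscale (1 / 2) (sbracket F F m) = 0.

Lemma bv_bracket0l b : bv_bracket (gr A) (D A) 0 b = 0.
Proof.
rewrite /bv_bracket big1 // => p _.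
by rewrite !(raddf0, mul0r, mulr0, subr0).
Qed.

Lemma bv_bracket0r a : bv_bracket (gr A) (D A) a 0 = 0.
Proof.
rewrite /bv_bracket big1 // => p _.
by rewrite !(raddf0, mulr0, subr0).
Qed.

Lemma iter_ad_small (S F : series A) : S 0%MM = 0 ->
  forall q m, (mdeg m < q)%N -> iter q (sbracket S) F m = 0.
Proof.
move=> S0; elim=> [//|q IHq] m; rewrite ltnS => le_mq /=.
rewrite /sbracket /kext; case: ifP => // _.
apply: big1 => -[I J] /= /eqP mE; apply: big1 => r _.
have [I0|nzI] := eqVneq (bmnm I) 0%MM.
  by rewrite I0 S0 bv_bracket0l !mulr0.
rewrite IHq ?raddf0 ?bv_bracket0r ?mulr0 //.
apply: leq_trans le_mq; have /(congr1 (@mdeg n)) := mE; rewrite mdegD => degE.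
have I_gt0 : (0 < mdeg I)%N by rewrite lt0n mdeg_eq0.
by have := leq_add I_gt0 (leqnn (mdeg J)); rewrite -degE add1n.
Qed.

End Series.

Section Solution.
Variables (k : algType rat) (gk : grading k) (A : dgbvAlgebra gk) (n : nat).
Variables (eps : 'I_n.+1 -> bool) (e : 'I_n.+1 -> homology A).

Record universal_solution (F : series n.+1 A) : Prop := UniversalSolution {
  usol_super : superseries eps F;
  usol_even : series_parity eps false F;
  usol_order0 : F 0%MM = 0;
  usol_mc : maurer_cartan eps F;
  usol_order1 : forall i, D A (F U_(i)%MM) = 0 /\ represents (F U_(i)%MM) (e i);
  usol_higher : forall m, (1 < mdeg m)%N -> range (D A) (F m);
  usol_t0 : forall m, (1 < mdeg m)%N -> m ord0 <> 0%N -> F m = 0 }.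

Record odd_parameter (S : series n.+1 A) : Prop := OddParameter {
  odd_param_super : superseries eps S;
  odd_param_odd : series_parity eps true S;
  odd_param_imD : coef_in (range (D A)) S;
  odd_param_order0 : S 0%MM = 0 }.

End Solution.

(* Main.v *)
(* All elements involved are Delta-closed, and for odd A and even Gamma that are
   Delta-closed [A . Gamma] = - Delta (A Gamma) and [Gamma . Gamma] = Delta (Gamma^2).
   Modulo t-order > N, Gamma(s) = e^{sA} . Gamma is a polynomial in s with
   Gamma' = - Delta (A Gamma) - delta A.  Along this flow the curvature
   C = 2 delta Gamma + Delta (Gamma^2) satisfies the linear equation
   C' = - Delta (A C), so the Maurer-Cartan equation is preserved.
   Up to a factor 12 the potential is the integral of 3 Gamma_1 Gamma^2 - Gamma^3;
   its s-derivative reduces to integrals of A Delta (Gamma^2) Gamma and of its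
   polarization, which vanish because A Delta (Gamma^3) integrates to 0 and
   Delta (Gamma^3) = 3 Delta (Gamma^2) Gamma.
   For the equivalence, A is built order by order: the difference of e^A . Gamma
   and the other solution in the lowest order where they differ is delta Delta c
   by the delta-Delta condition, and Delta c is the next term of A. *)

Require Import Defs.
From HB Require Import structures.
From mathcomp Require Import all_boot all_order all_algebra.
From mathcomp Require Import boolp classical_sets.
From mathcomp Require Import mpoly.

Set Implicit Arguments.
Unset Strict Implicit.
Unset Printing Implicit Defensive.

Import GRing.Theory.

Local Open Scope ring_scope.

(* The part of a DGBV structure used on [D]-closed elements: there the seven-term
   identity of a second order operator reduces to [bv_D_order2]. *)
Record bv_structure (R : nzRingType) (g : grading R) (d D : {additive R -> R}) : Prop :=
  BVStructure {
  bv_comm : graded_comm g;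
  bv_D_odd : forall p a, homogeneous g p a -> homogeneous g (~~ p) (D a);
  bv_d_odd : forall p a, homogeneous g p a -> homogeneous g (~~ p) (d a);
  bv_DD : forall a, D (D a) = 0;
  bv_dd : forall a, d (d a) = 0;
  bv_dD : forall a, d (D a) = - D (d a);
  bv_d_der : forall p a b, homogeneous g p a ->
    d (a * b) = d a * b + (-1) ^+ p * (a * d b);
  bv_D_order2 : forall p q a b c, homogeneous g p a -> homogeneous g q b ->
    D a = 0 -> D b = 0 -> D c = 0 ->
    D (a * b * c) = D (a * b) * c + (-1) ^+ p * (a * D (b * c))
                    + (-1) ^+ (~~ p && q) * (b * D (a * c)) }.

(** Stands in for division by integers: the coefficients of a derivative come as (i+1) c_{i+1}, and
    the factor has to be cancelled. *)
Definition torsion_free (V : zmodType) : Prop :=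
  forall (n : nat) (x : V), x *+ n.+1 = 0 -> x = 0.

(** * Homogeneous elements and the projections of a grading *)

Section Homogeneous.
Variables (V : zmodType) (g : grading V).

Lemma homogeneous_part p v : homogeneous g p (part g p v).
Proof. by rewrite /homogeneous part_part eqxx. Qed.

Lemma homogeneousD p u v :
  homogeneous g p u -> homogeneous g p v -> homogeneous g p (u + v).
Proof. by rewrite /homogeneous raddfD => -> ->. Qed.

Lemma homogeneousN p v : homogeneous g p v -> homogeneous g p (- v).
Proof. by rewrite /homogeneous raddfN => ->. Qed.

Lemma homogeneous0 p : homogeneous g p 0.
Proof. exact: raddf0. Qed.

Lemma part_homogeneous p q v :
  homogeneous g p v -> part g q v = if q == p then v else 0.
Proof. by move=> <-; rewrite part_part; case: eqP => // ->. Qed.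

Lemma part_odd (f : {additive V -> V}) p v :
  (forall q u, homogeneous g q u -> homogeneous g (~~ q) (f u)) ->
  part g p (f v) = f (part g (~~ p) v).
Proof.
move=> f_odd; rewrite -{1}(part_sum g v) !raddfD /=.
rewrite (part_homogeneous _ (f_odd _ _ (homogeneous_part false v))).
rewrite (part_homogeneous _ (f_odd _ _ (homogeneous_part true v))).
by case: p; rewrite /= ?addr0 ?add0r.
Qed.

End Homogeneous.

Lemma homogeneous_sign (R : nzRingType) (g : grading R) p (b : bool) (v : R) :
  homogeneous g p v -> homogeneous g p ((-1) ^+ b * v).
Proof. by rewrite mulr_sign; case: b => // /homogeneousN. Qed.

(** * Polynomials in the flow parameter *)

Section PolyLift.
Variables (R : nzRingType) (g : grading R) (d D : {additive R -> R}).
Hypothesis RBV : bv_structure g d D.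

Definition poly_part (p : bool) : {additive {poly R} -> {poly R}} :=
  map_poly (part g p).

Lemma poly_part_part p q v :
  poly_part p (poly_part q v) = if p == q then poly_part q v else 0.
Proof.
apply/polyP => i; rewrite !coef_map part_part.
by case: ifP; rewrite ?coef_map ?coef0.
Qed.

Lemma poly_part_sum v : poly_part false v + poly_part true v = v.
Proof. by apply/polyP => i; rewrite coefD !coef_map part_sum. Qed.

Definition poly_grading : grading {poly R} :=
  Grading poly_part_part poly_part_sum.

Lemma poly_homogeneousP p v :
  homogeneous poly_grading p v <-> forall i, homogeneous g p v`_i.
Proof.
split=> [<- i|hv]; first by rewrite coef_map; apply: homogeneous_part.
by rewrite /homogeneous; apply/polyP => i; rewrite coef_map; apply: hv.
Qed.

(** Only the monomials of [p] itself occur, so that properties of its coefficients, such as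
    homogeneity or closedness, remain available in the monomial case. *)
Lemma poly_additive_ind (Q : {poly R} -> Prop) (p : {poly R}) :
  Q 0 -> (forall u v, Q u -> Q v -> Q (u + v)) ->
  (forall i, Q ((p`_i)%:P * 'X^i)) -> Q p.
Proof.
move=> Q0 QD QM; rewrite -[p]coefK poly_def.
by apply: big_ind => // i _; rewrite -mul_polyC.
Qed.

Lemma mul_monomials (a b : R) i j :
  (a%:P * 'X^i) * (b%:P * 'X^j) = (a * b)%:P * 'X^(i + j).
Proof.
by rewrite -mulrA (mulrA 'X^i) -commr_polyXn -mulrA -exprD mulrA -polyCM.
Qed.

Lemma map_monomial (f : {additive R -> R}) a i :
  map_poly f (a%:P * 'X^i) = (f a)%:P * 'X^i.
Proof. by apply/polyP => j; rewrite coef_map !coefCM !coefXn !mulr_natr raddfMn. Qed.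

Lemma sign_monomial (b : bool) (a : R) i :
  (-1) ^+ b * (a%:P * 'X^i) = ((-1) ^+ b * a)%:P * 'X^i.
Proof. by rewrite !mulr_sign; case: b => //; rewrite polyCN mulNr. Qed.

(** The indeterminate is central and even, and [d], [D] act coefficientwise. The product identities
    are additive in each argument, hence reduce to monomials, where they are those of [R] times a
    power of the indeterminate. *)
Lemma poly_bv_structure : bv_structure poly_grading (map_poly d) (map_poly D).
Proof.
have [[h1 hM hC] hD hd DD dd dD der o2] := RBV.
split=> [|p a|p a|a|a|a|p a b|p q a b c].
- split=> [|p q a b|p q a b].
  + by apply/poly_homogeneousP => i; rewrite coef1; case: eqP => _; last exact: homogeneous0.
  + move=> /poly_homogeneousP ha /poly_homogeneousP hb.
    apply/poly_homogeneousP => i; rewrite coefM.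
    by apply: big_ind => [|u v|j _]; [exact: homogeneous0|exact: homogeneousD|exact: hM].
  + move=> /poly_homogeneousP ha /poly_homogeneousP hb.
    pattern a; apply: poly_additive_ind => [|u v eu ev|i].
    * by rewrite mul0r !mulr0.
    * by rewrite mulrDl eu ev mulrDr mulrDr.
    pattern b; apply: poly_additive_ind => [|u v eu ev|j].
    * by rewrite mul0r !mulr0.
    * by rewrite mulrDr eu ev mulrDl mulrDr.
    by rewrite !mul_monomials (hC _ _ _ _ (ha i) (hb j)) sign_monomial addnC.
- move=> /poly_homogeneousP ha; apply/poly_homogeneousP => i.
  by rewrite coef_map; apply: hD.
- move=> /poly_homogeneousP ha; apply/poly_homogeneousP => i.
  by rewrite coef_map; apply: hd.
- by apply/polyP => i; rewrite !coef_map DD coef0.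
- by apply/polyP => i; rewrite !coef_map dd coef0.
- by apply/polyP => i; rewrite coefN !coef_map.
- move=> /poly_homogeneousP ha.
  pattern a; apply: poly_additive_ind => [|u v eu ev|i].
  + by rewrite raddf0 !mul0r raddf0 mulr0 addr0.
  + by rewrite mulrDl !raddfD /= eu ev !mulrDl mulrDr addrACA.
  pattern b; apply: poly_additive_ind => [|u v eu ev|j].
  + by rewrite raddf0 !mulr0 raddf0 addr0.
  + by rewrite mulrDr !raddfD /= eu ev !mulrDr addrACA.
  by rewrite /= !(mul_monomials, map_monomial) (der _ _ _ (ha i)) sign_monomial -mulrDl -polyCD.
- move=> /poly_homogeneousP ha /poly_homogeneousP hb Da Db Dc.
  have cl (x : {poly R}) : map_poly D x = 0 -> forall i, D x`_i = 0.
    by move=> Dx i; rewrite -coef_map Dx coef0.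
  pattern a; apply: poly_additive_ind => [|u v eu ev|i].
  + by rewrite !(raddf0, mul0r, mulr0) !addr0.
  + rewrite !(raddfD, mulrDl, mulrDr) /= eu ev.
    by rewrite [LHS]addrACA [X in X + _ = _]addrACA.
  pattern b; apply: poly_additive_ind => [|u v eu ev|j].
  + by rewrite !(raddf0, mul0r, mulr0) !addr0.
  + rewrite !(raddfD, mulrDl, mulrDr) /= eu ev.
    by rewrite [LHS]addrACA [X in X + _ = _]addrACA.
  pattern c; apply: poly_additive_ind => [|u v eu ev|l].
  + by rewrite !(raddf0, mul0r, mulr0) !addr0.
  + rewrite !(raddfD, mulrDl, mulrDr) /= eu ev.
    by rewrite [LHS]addrACA [X in X + _ = _]addrACA.
  rewrite /= !(mul_monomials, map_monomial) !sign_monomial [(i + (j + l))%N]addnA.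
  rewrite [(j + (i + l))%N]addnCA addnA -!mulrDl -!polyCD.
  by rewrite -(o2 _ _ _ _ _ (ha i) (hb j) (cl _ Da i) (cl _ Db j) (cl _ Dc l)).
Qed.
End PolyLift.


(** * Infinitesimal gauge transformations *)

Section BVIdentities.
Variables (R : nzRingType) (g : grading R) (d D : {additive R -> R}).
Hypothesis RBV : bv_structure g d D.

Lemma even_mulC x y : homogeneous g false x -> x * y = y * x.
Proof.
have [[_ _ hC] _ _ _ _ _ _ _] := RBV.
move=> hx; rewrite -(part_sum g y) mulrDr mulrDl.
by congr (_ + _); rewrite (hC _ _ _ _ hx (homogeneous_part g _ y)) expr0 mul1r.
Qed.

Lemma odd_mulC x y :
  homogeneous g true x -> homogeneous g true y -> x * y = - (y * x).
Proof.
have [[_ _ hC] _ _ _ _ _ _ _] := RBV.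
by move=> hx hy; rewrite (hC _ _ _ _ hx hy) expr1 mulN1r.
Qed.

Lemma homogeneousM p q x y :
  homogeneous g p x -> homogeneous g q y -> homogeneous g (p (+) q) (x * y).
Proof. by have [[_ hM _] _ _ _ _ _ _ _] := RBV; apply: hM. Qed.

Lemma homogeneous_D p x : homogeneous g p x -> homogeneous g (~~ p) (D x).
Proof. by have [_ hD _ _ _ _ _ _] := RBV; apply: hD. Qed.

Lemma homogeneous_d p x : homogeneous g p x -> homogeneous g (~~ p) (d x).
Proof. by have [_ _ hd _ _ _ _ _] := RBV; apply: hd. Qed.

Lemma D_even_mul3 x y z : homogeneous g false x -> homogeneous g false y ->
  D x = 0 -> D y = 0 -> D z = 0 ->
  D (x * y * z) = D (x * y) * z + x * D (y * z) + y * D (x * z).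
Proof.
move=> hx hy Dx Dy Dz; have [_ _ _ _ _ _ _ o2] := RBV.
by rewrite (o2 _ _ _ _ _ hx hy Dx Dy Dz) !expr0 !mul1r.
Qed.

Lemma D_odd_mul3 a x y : homogeneous g true a -> homogeneous g false x ->
  D a = 0 -> D x = 0 -> D y = 0 ->
  D (a * x * y) = D (a * x) * y - a * D (x * y) + x * D (a * y).
Proof.
move=> ha hx Da Dx Dy; have [_ _ _ _ _ _ _ o2] := RBV.
by rewrite (o2 _ _ _ _ _ ha hx Da Dx Dy) expr1 expr0 mul1r mulN1r.
Qed.

(** With [y] the velocity of [x], the left side is the derivative of the curvature. Its terms in
    [d a] cancel, and [key] turns the remaining cubic term into that of the right side. *)
Lemma curvature_flow a x y : homogeneous g true a -> D a = 0 ->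
  homogeneous g false x -> D x = 0 -> y = - D (a * x) - d a ->
  d y *+ 2 + D (y * x + x * y) = - D (a * (d x *+ 2 + D (x * x))).
Proof.
move=> ha Da hx Dx yE; have [_ _ _ DD dd dD der _] := RBV.
have hy : homogeneous g false y.
  rewrite yE; apply: homogeneousD; apply: homogeneousN.
    exact: (homogeneous_D (homogeneousM ha hx)).
  exact: (homogeneous_d ha).
have dy : d y = D (d a * x) - D (a * d x).
  rewrite yE raddfB raddfN /= dd subr0 dD opprK (der _ _ _ ha) expr1 mulN1r.
  by rewrite raddfB.
(* [D] kills the left side of the second-order identity for [a * x * x]; on the right two terms
   agree since [x] is even. *)
have key : D (x * D (a * x)) *+ 2 = D (a * D (x * x)).
  have /(congr1 D) := D_odd_mul3 ha hx Da Dx Dx.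
  rewrite DD raddfD raddfB /= => /esym/eqP.
  rewrite addrAC subr_eq0 => /eqP <-.
  by rewrite mulr2n (even_mulC (D (a * x)) hx).
rewrite (even_mulC x hy) -mulr2n raddfMn -mulrnDl /=.
rewrite mulrDr raddfD /= -key mulrnAr raddfMn /= -mulrnDl -mulNrn; congr (_ *+ 2).
rewrite dy yE mulrBr mulrN raddfB raddfN /= (even_mulC (d a) hx).
by rewrite addrC addrA subrK [in RHS]opprD addrC.
Qed.

Variables (V : zmodType) (J : {additive R -> V}).
Hypothesis V_tf : torsion_free V.
Hypothesis J_d : forall x, J (d x) = 0.
Hypothesis J_D : forall p x y, homogeneous g p x ->
  J (D x * y) = J ((-1) ^+ p * (x * D y)).

Lemma J_closed_mulD a y : homogeneous g true a -> D a = 0 -> J (a * D y) = 0.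
Proof.
move=> ha Da; have := J_D y ha.
by rewrite Da mul0r raddf0 expr1 mulN1r raddfN => /esym/eqP; rewrite oppr_eq0 => /eqP.
Qed.

Lemma J_even_mulD x y : homogeneous g false x -> J (x * D y) = J (D x * y).
Proof. by move=> hx; rewrite (J_D _ hx) expr0 mul1r. Qed.

Lemma J_cubic a x : homogeneous g true a -> D a = 0 ->
  homogeneous g false x -> D x = 0 -> J (a * D (x * x) * x) = 0.
Proof.
move=> ha Da hx Dx; apply: (V_tf (n := 2)).
have := J_closed_mulD (x * x * x) ha Da.
rewrite (D_even_mul3 hx hx Dx Dx Dx) (even_mulC _ hx) => <-.
by rewrite -raddfMn !mulrDr mulrA mulrSr mulr2n.
Qed.

(** The computation of [J_cubic] for [y * x * x], where only two of the three terms of the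
    second-order identity coincide. *)
Lemma J_cubic_polarized a x y : homogeneous g true a -> D a = 0 ->
  homogeneous g false x -> D x = 0 -> homogeneous g false y -> D y = 0 ->
  J (a * D (y * x) * x) *+ 2 + J (a * D (x * x) * y) = 0.
Proof.
move=> ha Da hx Dx hy Dy.
have := J_closed_mulD (y * x * x) ha Da.
rewrite (D_even_mul3 hy hx Dy Dx Dx) (even_mulC (D (y * x)) hx) (even_mulC (D (x * x)) hy) => <-.
by rewrite !mulrDr !mulrA !raddfD /= mulr2n addrAC.
Qed.

(** Integration by parts moves [d] onto [x * x]; the Maurer-Cartan equation gives
    [d (x * x) = - D (x * x) * x], and [J_cubic] applies. *)
Lemma J_square_d a x : homogeneous g true a -> D a = 0 ->
  homogeneous g false x -> D x = 0 -> d x *+ 2 + D (x * x) = 0 ->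
  J (x * x * d a) = 0.
Proof.
move=> ha Da hx Dx mc; have [_ _ _ _ _ _ der _] := RBV.
have hxx := homogeneousM hx hx.
have := J_d (x * x * a); rewrite (der _ _ _ hxx) expr0 mul1r raddfD /=.
suff -> : J (d (x * x) * a) = 0 by rewrite add0r.
have -> : d (x * x) = - D (x * x) * x.
  rewrite (der _ _ _ hx) expr0 mul1r (even_mulC (d x) hx) -mulr2n -mulrnAl.
  by congr (_ * _); apply/eqP; rewrite -addr_eq0 mc.
rewrite -mulrA (even_mulC _ hx) mulrA mulNr -(odd_mulC ha (homogeneous_D hxx)).
exact: J_cubic.
Qed.

(* With [x] the solution, [y] its linear part, [x'] and [y'] their derivatives
   along the flow: the value is the derivative of [J (3 y x^2 - x^3)]. *)
Lemma potential_flow a b x y x' y' :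
  homogeneous g true a -> D a = 0 -> homogeneous g true b -> D b = 0 ->
  homogeneous g false x -> D x = 0 ->
  homogeneous g false y -> D y = 0 -> d y = 0 ->
  d x *+ 2 + D (x * x) = 0 ->
  x' = - D (a * x) - d a -> y' = - d b ->
  J ((y' * (x * x) + y * (x' * x + x * x')) *+ 3
     - (x' * (x * x) + x * (x' * x + x * x'))) = 0.
Proof.
move=> ha Da hb Db hx Dx hy Dy dy mc x'E y'E.
have [_ _ _ DD _ _ der _] := RBV.
have hxx := homogeneousM hx hx; have hyx := homogeneousM hy hx.
have hax := homogeneousM ha hx.
have hx' : homogeneous g false x'.
  rewrite x'E; apply: homogeneousD; apply: homogeneousN.
    exact: (homogeneous_D hax).
  exact: (homogeneous_d ha).
(* As [x'] is even, the argument of [J] is [3 y' x^2 + 6 y x x' - 3 x^2 x']; its three terms vanish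
   separately under [J]. *)
have E1 : J (x * x * x') = 0.
  rewrite x'E mulrDr raddfD !mulrN !raddfN /= (J_square_d ha Da hx Dx mc).
  rewrite (J_even_mulD _ hxx) mulrA (odd_mulC (homogeneous_D hxx) ha) mulNr raddfN.
  by rewrite J_cubic // !oppr0 addr0.
have E2 : J (y' * (x * x)) = 0.
  by rewrite y'E -(even_mulC _ hxx) mulrN raddfN /= J_square_d ?oppr0.
(* The two parts of [x'] give the two terms of [J_cubic_polarized]: [- D (a * x)] by moving [D], and
   [- d a] by moving [d] and using [d y = 0] and the Maurer-Cartan equation. *)
have E3 : J (y * x * x') *+ 2 = 0.
  rewrite -(J_cubic_polarized ha Da hx Dx hy Dy).
  rewrite x'E mulrDr raddfD mulrnDl !mulrN !raddfN /=; congr (_ *+ 2 + _).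
    by rewrite (J_even_mulD _ hyx) mulrA (odd_mulC (homogeneous_D hyx) ha) mulNr raddfN opprK.
  have := J_d (y * x * a); rewrite (der _ _ _ hyx) expr0 mul1r raddfD /=.
  rewrite addrC => /eqP; rewrite addr_eq0 => /eqP ->; rewrite opprK.
  rewrite (der _ _ _ hy) dy mul0r add0r expr0 mul1r -raddfMn /=.
  rewrite -mulrnAl -mulrnAr.
  have -> : d x *+ 2 = - D (x * x) by apply/eqP; rewrite -addr_eq0 mc.
  rewrite mulrN mulNr -mulrA (even_mulC _ hy).
  by rewrite (odd_mulC (homogeneous_D hxx) ha) mulNr opprK.
have -> : x' * x + x * x' = x * x' *+ 2 by rewrite (even_mulC _ hx') mulr2n.
rewrite (even_mulC (x * x) hx') !mulrnAr !mulrA.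
rewrite raddfB raddfMn raddfD (raddfD _ (x * x * x')) !raddfMn /=.
by rewrite -mulrA E1 E2 add0r E3 !mul0rn addr0 subr0.
Qed.

End BVIdentities.

(** * Integrating the flow from time 0 to time 1 *)

Lemma horner1_coef (R : nzRingType) (p : {poly R}) :
  p.[1] = \sum_(i < size p) p`_i.
Proof. by rewrite horner_coef; apply: eq_bigr => i _; rewrite expr1n mulr1. Qed.

Lemma horner1_map (R : nzRingType) (V : zmodType) (f : {additive R -> V}) (p : {poly R}) :
  f p.[1] = \sum_(i < size p) f p`_i.
Proof. by rewrite horner1_coef raddf_sum. Qed.

Lemma horner1M (R : nzRingType) (p q : {poly R}) : (p * q).[1] = p.[1] * q.[1].
Proof. by apply: hornerM_comm; rewrite /comm_poly mul1r mulr1. Qed.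

Section Flow.
Variables (R : nzRingType) (g : grading R) (d D : {additive R -> R}).
Hypothesis RBV : bv_structure g d D.
Hypothesis R_tf : torsion_free R.
Variables (a : R) (x : {poly R}).
Hypotheses (a_odd : homogeneous g true a) (Da : D a = 0).
Hypotheses (x_even : forall i, homogeneous g false x`_i) (Dx : forall i, D x`_i = 0).
Hypothesis x_flow : x^`() = - map_poly D (a%:P * x) - (d a)%:P.
Hypothesis mc0 : d x`_0 *+ 2 + D (x`_0 * x`_0) = 0.

Let PBV := poly_bv_structure RBV.

Let aP_odd : homogeneous (poly_grading g) true a%:P.
Proof.
by apply/poly_homogeneousP => i; rewrite coefC; case: eqP => _ //; exact: homogeneous0.
Qed.

Let DaP : map_poly D a%:P = 0.
Proof. by rewrite map_polyC Da. Qed.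

Let xP_even : homogeneous (poly_grading g) false x.
Proof. exact/poly_homogeneousP. Qed.

Let DxP : map_poly D x = 0.
Proof. by apply/polyP => i; rewrite coef_map Dx coef0. Qed.

Let x_flowP : x^`() = - map_poly D (a%:P * x) - map_poly d a%:P.
Proof. by rewrite x_flow map_polyC. Qed.

Lemma deriv_map (f : {additive R -> R}) (p : {poly R}) :
  (map_poly f p)^`() = map_poly f p^`().
Proof. by apply/polyP => i; rewrite coef_deriv !coef_map coef_deriv raddfMn. Qed.

(** The curvature [c] solves a linear equation, (i+1) c_{i+1} = - D (a c_i) in coefficients, with
    c_0 = 0 by [mc0]; all coefficients vanish by induction. *)
Lemma flow_curvature : map_poly d x *+ 2 + map_poly D (x * x) = 0.
Proof.
set c := LHS.
have cE : c^`() = - map_poly D (a%:P * c).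
  rewrite /c derivD derivMn !deriv_map derivM.
  exact: (curvature_flow PBV aP_odd DaP xP_even DxP x_flowP).
apply/polyP => i; rewrite coef0; elim: i => [|i IHi].
  by rewrite /c coefD coefMn !coef_map coef0M mc0.
apply: (R_tf (n := i)); rewrite -coef_deriv cE coefN coef_map coefCM IHi.
by rewrite mulr0 raddf0 oppr0.
Qed.

Lemma flow_end_curvature : d x.[1] *+ 2 + D (x.[1] * x.[1]) = 0.
Proof.
have h (f : {additive R -> R}) (p : {poly R}) : (map_poly f p).[1] = f p.[1].
  rewrite horner1_map (horner_coef_wide _ (size_poly _ _ : size (map_poly f p) <= size p)%N).
  by apply: eq_bigr => i _; rewrite expr1n mulr1 coef_map.
by rewrite -horner1M -!h -hornerMn -hornerD flow_curvature horner0.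
Qed.

Variables (b : R) (y : {poly R}).
Hypotheses (b_odd : homogeneous g true b) (Db : D b = 0).
Hypotheses (y_even : forall i, homogeneous g false y`_i) (Dy : forall i, D y`_i = 0).
Hypotheses (dy : forall i, d y`_i = 0) (y_flow : y^`() = - (d b)%:P).
Variables (V : zmodType) (J : {additive R -> V}).
Hypothesis V_tf : torsion_free V.
Hypothesis J_d : forall u, J (d u) = 0.
Hypothesis J_D : forall p u v, homogeneous g p u ->
  J (D u * v) = J ((-1) ^+ p * (u * D v)).

(** A polynomial whose coefficients of positive degree are killed by [J] has the same image under
    [J] at times 0 and 1. These coefficients are, up to integer factors, those of the derivative
    treated in [potential_flow]. *)
Lemma flow_potential :
  J ((y.[1] * (x.[1] * x.[1])) *+ 3 - x.[1] * (x.[1] * x.[1])) =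
  J ((y`_0 * (x`_0 * x`_0)) *+ 3 - x`_0 * (x`_0 * x`_0)).
Proof.
pose P := (y * (x * x)) *+ 3 - x * (x * x).
have -> : (y.[1] * (x.[1] * x.[1])) *+ 3 - x.[1] * (x.[1] * x.[1]) = P.[1].
  by rewrite /P hornerD hornerN hornerMn !horner1M.
have -> : (y`_0 * (x`_0 * x`_0)) *+ 3 - x`_0 * (x`_0 * x`_0) = P`_0.
  by rewrite /P coefB coefMn !coef0M.
have bP_odd : homogeneous (poly_grading g) true b%:P.
  by apply/poly_homogeneousP => i; rewrite coefC; case: eqP => _ //; exact: homogeneous0.
have DbP : map_poly D b%:P = 0 by rewrite map_polyC Db.
have yP_even : homogeneous (poly_grading g) false y by apply/poly_homogeneousP.
have DyP : map_poly D y = 0 by apply/polyP => i; rewrite coef_map Dy coef0.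
have dyP : map_poly d y = 0 by apply/polyP => i; rewrite coef_map dy coef0.
have y_flowP : y^`() = - map_poly d b%:P by rewrite y_flow map_polyC.
have PS i : J P`_i.+1 = 0.
  apply: (V_tf (n := i)); rewrite -raddfMn -coef_deriv.
  have -> : P^`() = (y^`() * (x * x) + y * (x^`() * x + x * x^`())) *+ 3
     - (x^`() * (x * x) + x * (x^`() * x + x * x^`())).
    by rewrite /P derivB derivMn !derivM.
  (* Followed by the choice of one coefficient, [J] becomes a functional on polynomials that still
     kills [d]-exact elements and integrates [D] by parts. *)
  pose Ji : {additive {poly R} -> V} := J \o coefp i.
  apply: (potential_flow PBV (J := Ji) V_tf _ _ aP_odd DaP bP_odd DbP xP_even DxP
    yP_even DyP dyP flow_curvature x_flowP y_flowP).
    by move=> u; rewrite /Ji /= coef_map.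
  move=> p u v /poly_homogeneousP hu; rewrite /Ji /=.
  rewrite coefM raddf_sum -signr_odd; case: p hu => hu; rewrite ?expr0 ?expr1 ?mul1r.
    rewrite mulN1r coefN coefM raddfN raddf_sum -sumrN; apply: eq_bigr => j _.
    by rewrite !coef_map (J_D _ (hu j)) expr1 mulN1r raddfN.
  rewrite coefM raddf_sum; apply: eq_bigr => j _.
  by rewrite !coef_map (J_D _ (hu j)) expr0 mul1r.
rewrite (horner1_map J); case sP: (size P) => [|s].
  by rewrite big_ord0 nth_default ?sP ?raddf0.
by rewrite big_ord_recl big1 ?addr0 // => i _; exact: PS.
Qed.

End Flow.


(** * The second-order identity in a DGBV algebra *)

Lemma bv_bracket_closed (R : nzRingType) (g : grading R) (D : {additive R -> R}) p a b :
  homogeneous g p a -> D a = 0 ->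
  bv_bracket g D a b = (-1) ^+ p * D (a * b) - a * D b.
Proof.
move=> ha Da; rewrite /bv_bracket (bigD1 p) //= big1 => [|q /negPf neq_qp].
  by rewrite ha Da mul0r subr0 addr0 mulrBr signrMK.
by rewrite (part_homogeneous _ ha) neq_qp !(raddf0, mul0r, mulr0, subr0, addr0).
Qed.

(** The derivation rule for the bracket of [a] with [b * c], written out by [bv_bracket_closed] and
    multiplied by [(-1) ^+ p], is the second-order identity. The product [b * c] need not be closed,
    whence the term in [D (b * c)]. *)
Lemma dgbv_bv_structure (k : nzRingType) (gk : grading k) (A : dgbvAlgebra gk) :
  bv_structure (gr A) (d A) (D A).
Proof.
have [_ D_hom _] := D_odd A; have [_ d_hom _] := d_odd A.
split=> //.
- exact: gr_comm.
- exact: D_sq.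
- exact: d_sq.
- by move=> a; apply/eqP; rewrite -addr_eq0 dD_anti.
- exact: d_der.
move=> p q a b c ha hb Da Db Dc.
have := bracket_der c ha hb.
rewrite !(bv_bracket_closed _ ha Da) Db Dc !mulr0 !subr0 => /eqP; rewrite subr_eq => /eqP.
move=> /(congr1 ( *%R ((-1) ^+ p))); rewrite signrMK !mulrDr mulrA => ->.
rewrite mulrA signrMK addrAC; congr (_ + _ + _).
by rewrite !mulr_sign; case: p {ha}; case: (_ && q); rewrite ?mulrN ?opprK.
Qed.

(** * Truncated super power series *)

Section Truncated.
Variables (k : algType rat) (gk : grading k) (A : dgbvAlgebra gk) (n : nat).
Variable eps : 'I_n -> bool.

Lemma admissible_addl I J : admissible eps (I + J)%MM -> admissible eps I.
Proof.
move=> /forallP h; apply/forallP => i; apply/implyP => ei.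
have := h i; rewrite ei /= mnmDE; apply: leq_trans; exact: leq_addr.
Qed.

Lemma admissible_addr I J : admissible eps (I + J)%MM -> admissible eps J.
Proof. by rewrite addmC; apply: admissible_addl. Qed.

Lemma mparityD I J : mparity eps (I + J)%MM = mparity eps I (+) mparity eps J.
Proof.
rewrite /mparity -oddD; congr odd; rewrite -big_split /=.
by apply: eq_bigr => i _; rewrite mnmDE.
Qed.

Lemma mparity0 : mparity eps 0%MM = false.
Proof. by rewrite /mparity big1 // => i _; rewrite mnm0E. Qed.

Lemma swapsDl I J K : swaps eps (I + J)%MM K = (swaps eps I K + swaps eps J K)%N.
Proof.
rewrite /swaps -big_split /=; apply: eq_bigr => i _.
by rewrite -big_split /=; apply: eq_bigr => j _; rewrite mnmDE mulnDl.
Qed.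

Lemma swapsDr I J K : swaps eps K (I + J)%MM = (swaps eps K I + swaps eps K J)%N.
Proof.
rewrite /swaps -big_split /=; apply: eq_bigr => i _.
by rewrite -big_split /=; apply: eq_bigr => j _; rewrite mnmDE mulnDr.
Qed.

Lemma swaps0l K : swaps eps 0%MM K = 0%N.
Proof. by rewrite /swaps !big1 // => i _; rewrite big1 // => j _; rewrite mnm0E. Qed.

Lemma swaps0r K : swaps eps K 0%MM = 0%N.
Proof. by rewrite /swaps !big1 // => i _; rewrite big1 // => j _; rewrite mnm0E muln0. Qed.

(** The product of the two odd degrees is a double sum over pairs of odd variables. Its parts below
    and above the diagonal count the swaps in the two orders, and the diagonal vanishes because no
    odd variable occurs twice. *)
Lemma swapsC I J : admissible eps (I + J)%MM ->
  odd (swaps eps J I) = odd (swaps eps I J) (+) (mparity eps I && mparity eps J).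
Proof.
move=> /forallP adm.
suff E : ((\sum_(i < n | eps i) I i) * (\sum_(i < n | eps i) J i)
          = swaps eps I J + swaps eps J I)%N.
  by rewrite /mparity -oddM E oddD addbA addbb addFb.
have IJ0 i : eps i -> (I i * J i = 0)%N.
  by have := adm i => /[swap] ->; rewrite mnmDE; case: (I i) (J i) => [|[|a]] [|[|b]].
rewrite big_distrlr /= /swaps.
rewrite [X in (_ + X)%N](exchange_big_dep eps) => [|i j _ /andP[]//] /=.
rewrite -big_split; apply: eq_bigr => i ei /=.
rewrite (bigID (fun j : 'I_n => (j < i)%N)) /=; congr (_ + _)%N.
rewrite (bigD1 i) /=; last by rewrite ei ltnn.
rewrite IJ0 // add0n; apply: eq_big => [j|j _]; last by rewrite mulnC.
by rewrite ei -leqNgt ltn_neqAle -val_eqE eq_sym; case: (eps j); rewrite // andbC.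
Qed.

Lemma kext_local q B (F F' G G' : series n A) m :
  (forall I J r, m = (I + J)%MM ->
     B (F I) (part (gr A) r (G J)) = B (F' I) (part (gr A) r (G' J))) ->
  kext eps q B F G m = kext eps q B F' G' m.
Proof.
move=> h; rewrite /kext; case: ifP => // _; apply: eq_bigr => -[I J] /= /eqP mE.
by apply: eq_bigr => r _; rewrite (h _ _ _ mE).
Qed.

(** Without constant terms, both factors of a contribution of order at most [M] have order below
    [M]. *)
Lemma kext_local_lt q B (F F' G G' : series n A) M m :
  (forall b, B 0 b = 0) -> (forall a, B a 0 = 0) ->
  F 0%MM = 0 -> F' 0%MM = 0 -> G 0%MM = 0 -> G' 0%MM = 0 ->
  (forall I, (mdeg I < M)%N -> F I = F' I) ->
  (forall I, (mdeg I < M)%N -> G I = G' I) -> (mdeg m <= M)%N ->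
  kext eps q B F G m = kext eps q B F' G' m.
Proof.
move=> B0l B0r F0 F'0 G0 G'0 eqF eqG le_mM; apply: kext_local => I J r mE.
have [->|nzI] := eqVneq I 0%MM; first by rewrite F0 F'0 !B0l.
have [->|nzJ] := eqVneq J 0%MM; first by rewrite G0 G'0 !raddf0 !B0r.
rewrite mE mdegD in le_mM; rewrite -mdeg_eq0 -lt0n in nzI; rewrite -mdeg_eq0 -lt0n in nzJ.
rewrite eqF ?eqG //; apply: leq_trans le_mM.
  by rewrite -add1n leq_add2r.
by rewrite -addn1 leq_add2l.
Qed.

Lemma smulDl (F F' G : series n A) m :
  smul eps (fun m => F m + F' m) G m = smul eps F G m + smul eps F' G m.
Proof.
rewrite /smul /kext; case: ifP => _; last by rewrite addr0.
rewrite -big_split; apply: eq_bigr => IJ _ /=; rewrite -big_split.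
by apply: eq_bigr => r _ /=; rewrite mulrDl !mulrDr.
Qed.

Lemma smulDr (F G G' : series n A) m :
  smul eps F (fun m => G m + G' m) m = smul eps F G m + smul eps F G' m.
Proof.
rewrite /smul /kext; case: ifP => _; last by rewrite addr0.
rewrite -big_split; apply: eq_bigr => IJ _ /=; rewrite -big_split.
by apply: eq_bigr => r _ /=; rewrite raddfD !mulrDr.
Qed.

Definition smono (I : 'X_{1..n}) (x : A) : series n A :=
  fun m => if m == I then x else 0.

(* (x t^I) (y t^J) = (-1)^(koszul I J |y|) (x y) t^(I + J) *)
Definition koszul (I J : 'X_{1..n}) (r : bool) : bool :=
  odd (swaps eps I J) (+) (mparity eps I && r).

Lemma smul_smono I J r x y m : homogeneous (gr A) r y ->
  smul eps (smono I x) (smono J y) m =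
  if admissible eps m && (m == I + J)%MM then (-1) ^+ koszul I J r * (x * y) else 0.
Proof.
move=> hy; rewrite /smul /kext; case: ifP => //= _.
case: eqP => [mE|neq].
  have bI : (mdeg I < (mdeg m).+1)%N by rewrite mE mdegD ltnS leq_addr.
  have bJ : (mdeg J < (mdeg m).+1)%N by rewrite mE mdegD ltnS leq_addl.
  rewrite (bigD1 (BMultinom bI, BMultinom bJ)) /=; last by rewrite -mE.
  rewrite [X in _ + X]big1 => [|[I' J'] /andP[_ neq]]; last first.
    apply: big1 => s _; rewrite /smono /=.
    case: eqP => [eI|]; last by rewrite mul0r !mulr0.
    case: eqP => [eJ|]; last by rewrite raddf0 !mulr0.
    by case/negP: neq; apply/eqP; congr (_, _); apply: val_inj.
  rewrite addr0 (bigD1 r) //= big1 => [|s /negPf neq]; last first.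
    by rewrite /smono !eqxx (part_homogeneous _ hy) neq !mulr0.
  rewrite /smono !eqxx addr0 hy mulrA; congr (_ * _).
  by rewrite /koszul signr_addb -signr_odd.
apply: big1 => -[I' J'] /= /eqP mE; apply: big1 => s _; rewrite /smono /=.
case: eqP => [eI|]; last by rewrite mul0r !mulr0.
case: eqP => [eJ|]; last by rewrite raddf0 !mulr0.
by case: neq; rewrite mE eI eJ.
Qed.


(** * The ring of super power series modulo order > N *)

Variable N : nat.

(* Working modulo monomials of order > N, every series is a finite sum of
   monomials, and power series in an extra parameter become polynomials. *)
Definition tindex : finType := {m : 'X_{1..n < N.+1} | admissible eps m}.

Definition tmon (i : tindex) : 'X_{1..n} := bmnm (val i).

Definition tser : Type := {ffun tindex -> A}.
HB.instance Definition _ := GRing.Zmodule.on tser.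

Definition trunc (F : series n A) : tser := [ffun i => F (tmon i)].

(** At most one index is summed, by [tmon_inj]; the value is 0 where the truncation holds no
    coefficient. *)
Definition extend (F : tser) : series n A := fun m => \sum_(i | tmon i == m) F i.

Definition mono (I : 'X_{1..n}) (x : A) : tser := trunc (smono I x).

Definition tmul (F G : tser) : tser := trunc (smul eps (extend F) (extend G)).

Lemma tmon_admissible i : admissible eps (tmon i).
Proof. exact: (valP i). Qed.

Lemma tmon_mdeg i : (mdeg (tmon i) <= N)%N.
Proof. by rewrite -ltnS; apply: bmdeg. Qed.

Lemma tmonP m : admissible eps m -> (mdeg m <= N)%N -> exists i, tmon i = m.
Proof.
rewrite -ltnS => adm le_mN.
by exists (exist _ (BMultinom le_mN) adm).
Qed.

Lemma tmon_inj : injective tmon.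
Proof. by move=> i j /val_inj/val_inj. Qed.

Lemma extend_tmon F i : extend F (tmon i) = F i.
Proof. by rewrite /extend (big_pred1 i) // => j; rewrite (inj_eq tmon_inj). Qed.

Lemma extend_trunc F m : admissible eps m -> (mdeg m <= N)%N ->
  extend (trunc F) m = F m.
Proof. by move=> adm le_mN; have [i <-] := tmonP adm le_mN; rewrite extend_tmon ffunE. Qed.

Lemma extendD F G : extend (F + G) = (fun m => extend F m + extend G m).
Proof.
apply: funext => m; rewrite /extend -big_split.
by apply: eq_bigr => i _; rewrite ffunE.
Qed.

(** Factors of an admissible monomial of order at most [N] are again such, so truncation loses
    nothing that the product uses. *)
Lemma trunc_smul F G : trunc (smul eps F G) = tmul (trunc F) (trunc G).
Proof.
apply/ffunP => i; rewrite !ffunE; apply: kext_local => I J r mE.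
have adm := tmon_admissible i; have deg := tmon_mdeg i.
rewrite mE in adm deg; rewrite mdegD in deg.
rewrite !extend_trunc //; [exact: admissible_addr adm| |exact: admissible_addl adm|].
  exact: leq_trans (leq_addl _ _) deg.
exact: leq_trans (leq_addr _ _) deg.
Qed.

Lemma tmulDl : left_distributive tmul +%R.
Proof. by move=> F G H; apply/ffunP => i; rewrite !ffunE extendD smulDl. Qed.

Lemma tmulDr : right_distributive tmul +%R.
Proof. by move=> F G H; apply/ffunP => i; rewrite !ffunE extendD smulDr. Qed.

Lemma mono_zmod_morphism I : zmod_morphism (mono I).
Proof. by move=> x y; apply/ffunP => i; rewrite !ffunE /smono; case: ifP; rewrite ?subr0. Qed.

HB.instance Definition _ I :=
  GRing.isZmodMorphism.Build A tser (mono I) (mono_zmod_morphism I).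

Lemma mono_nonadm I x : ~~ admissible eps I -> mono I x = 0.
Proof.
move=> nadm; apply/ffunP => i; rewrite !ffunE /smono.
by case: eqP => // iI; case/negP: nadm; rewrite -iI tmon_admissible.
Qed.

Lemma tmul_mono I J r x y : homogeneous (gr A) r y ->
  tmul (mono I x) (mono J y) = mono (I + J)%MM ((-1) ^+ koszul I J r * (x * y)).
Proof.
move=> hy; rewrite -trunc_smul; apply/ffunP => i; rewrite !ffunE.
by rewrite (smul_smono _ _ _ _ hy) tmon_admissible /smono.
Qed.

Lemma tser_monoE (F : tser) : F = \sum_i mono (tmon i) (F i).
Proof.
apply/ffunP => j; rewrite sum_ffunE (bigD1 j) //= big1 => [|i neq].
  by rewrite ffunE /smono eqxx addr0.
by rewrite ffunE /smono (inj_eq tmon_inj) eq_sym (negPf neq).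
Qed.

(** Keeps the coefficients of [F], for goals with hypotheses on them; [tser_mono_ind] offers
    homogeneous coefficients instead. *)
Lemma tser_coef_ind (Q : tser -> Prop) (F : tser) :
  Q 0 -> (forall G H, Q G -> Q H -> Q (G + H)) ->
  (forall i, Q (mono (tmon i) (F i))) -> Q F.
Proof. by move=> Q0 QD QM; rewrite (tser_monoE F); apply: big_ind. Qed.

Lemma tser_mono_ind (Q : tser -> Prop) :
  Q 0 -> (forall G H, Q G -> Q H -> Q (G + H)) ->
  (forall I p x, homogeneous (gr A) p x -> Q (mono I x)) -> forall F, Q F.
Proof.
move=> Q0 QD QM F; apply: tser_coef_ind => // i.
rewrite -(part_sum (gr A) (F i)) raddfD.
by apply: QD; apply: (QM _ _ _ (homogeneous_part _ _ _)).
Qed.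

Lemma tmul0F F : tmul 0 F = 0.
Proof. by apply: (addIr (tmul 0 F)); rewrite -tmulDl !add0r. Qed.

Lemma tmulF0 F : tmul F 0 = 0.
Proof. by apply: (addIr (tmul F 0)); rewrite -tmulDr !add0r. Qed.

Let ABV := dgbv_bv_structure A.

(** The two sides are the sign exponents of the two bracketings of x t^I, y t^J, z t^K with [p], [q]
    the parities of y, z. *)
Lemma koszulA I J K p q :
  koszul I (J + K)%MM (p (+) q) (+) koszul J K q =
  koszul (I + J)%MM K q (+) koszul I J p.
Proof.
rewrite /koszul swapsDl swapsDr mparityD !oddD.
case: (odd (swaps _ I J)); case: (odd (swaps _ I K)); case: (odd (swaps _ J K)).
all: by case: (mparity _ I); case: (mparity _ J); case: p; case: q.
Qed.

Lemma tmulA : associative tmul.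
Proof.
move=> F G H.
move: F; apply: tser_mono_ind => [|F F' eF eF'|I o x hx]; first by rewrite !tmul0F.
  by rewrite !tmulDl eF eF'.
move: G; apply: tser_mono_ind => [|F F' eF eF'|J p y hy]; first by rewrite !(tmul0F, tmulF0).
  by rewrite !(tmulDl, tmulDr) eF eF'.
move: H; apply: tser_mono_ind => [|F F' eF eF'|K q z hz]; first by rewrite !(tmul0F, tmulF0).
  by rewrite !(tmulDl, tmulDr) eF eF'.
have hyz := homogeneous_sign (koszul J K q) (homogeneousM ABV hy hz).
rewrite (tmul_mono _ _ _ hz) (tmul_mono _ _ _ hyz) (tmul_mono _ _ _ hy) (tmul_mono _ _ _ hz).
rewrite addmA; congr (mono _ _).
have := koszulA I J K p q.
case: (koszul I (J + K)%MM _); case: (koszul J K _); case: (koszul (I + J)%MM K _);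
case: (koszul I J _) => // _.
all: by rewrite !(expr0, expr1, mul1r, mulr1, mulN1r, mulrN, mulNr, mulrA, opprK).
Qed.

Definition tone : tser := mono 0%MM 1.

Lemma tmul1F : left_id tone tmul.
Proof.
apply: tser_mono_ind => [|F F' eF eF'|I p x hx]; first by rewrite tmulF0.
  by rewrite tmulDr eF eF'.
by rewrite (tmul_mono _ _ _ hx) /koszul swaps0l mparity0 add0m expr0 !mul1r.
Qed.

Lemma tmulF1 : right_id tone tmul.
Proof.
have [[h1 _ _] _ _ _ _ _ _ _] := ABV.
apply: tser_mono_ind => [|F F' eF eF'|I p x hx]; first by rewrite tmul0F.
  by rewrite tmulDl eF eF'.
by rewrite (tmul_mono _ _ _ h1) /koszul swaps0r andbF addm0 expr0 mul1r mulr1.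
Qed.

Lemma tone_neq0 : tone != 0.
Proof.
have adm0 : admissible eps 0%MM by apply/forallP => i; rewrite mnm0E implybT.
have [|i i0] := tmonP adm0 _; first by rewrite mdeg0.
apply/eqP => /ffunP/(_ i); rewrite !ffunE /smono i0 eqxx => /eqP.
by rewrite oner_eq0.
Qed.

HB.instance Definition _ := GRing.Zmodule_isNzRing.Build tser
  tmulA tmul1F tmulF1 tmulDl tmulDr tone_neq0.

Lemma mono_mul I J r x y : homogeneous (gr A) r y ->
  mono I x * mono J y = mono (I + J)%MM ((-1) ^+ koszul I J r * (x * y)).
Proof. exact: tmul_mono. Qed.

Lemma trunc_mul F G : trunc (smul eps F G) = trunc F * trunc G.
Proof. exact: trunc_smul. Qed.

Definition tmap (f : A -> A) (F : tser) : tser := [ffun i => f (F i)].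

Lemma tmap_zmod_morphism (f : {additive A -> A}) : zmod_morphism (tmap f).
Proof. by move=> F G; apply/ffunP => i; rewrite !ffunE raddfB. Qed.

HB.instance Definition _ (f : {additive A -> A}) :=
  GRing.isZmodMorphism.Build tser tser (tmap f) (tmap_zmod_morphism f).

Lemma tmap_mono (f : {additive A -> A}) I x : tmap f (mono I x) = mono I (f x).
Proof. by apply/ffunP => i; rewrite !ffunE /smono; case: ifP; rewrite ?raddf0. Qed.

(** The total parity of x t^m is the parity of x plus that of t^m. *)
Definition tpart (p : bool) (F : tser) : tser :=
  [ffun i => part (gr A) (p (+) mparity eps (tmon i)) (F i)].

Lemma tpart_zmod_morphism p : zmod_morphism (tpart p).
Proof. by move=> F G; apply/ffunP => i; rewrite !ffunE raddfB. Qed.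

HB.instance Definition _ p :=
  GRing.isZmodMorphism.Build tser tser (tpart p) (tpart_zmod_morphism p).

Lemma tpart_part p q F : tpart p (tpart q F) = if p == q then tpart q F else 0.
Proof.
apply/ffunP => i; rewrite !ffunE part_part (inj_eq (can_inj (addbK _))).
by case: ifP; rewrite !ffunE.
Qed.

Lemma tpart_sum F : tpart false F + tpart true F = F.
Proof.
apply/ffunP => i; rewrite !ffunE; case: mparity => /=; last exact: part_sum.
by rewrite addrC part_sum.
Qed.

Definition tgrading : grading tser := @Grading tser (fun p => tpart p) tpart_part tpart_sum.

Lemma thomogeneousP p F :
  homogeneous tgrading p F <->
  forall i, homogeneous (gr A) (p (+) mparity eps (tmon i)) (F i).
Proof.
split=> [/ffunP h i|h]; last by apply/ffunP => i; rewrite ffunE h.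
by have := h i; rewrite ffunE.
Qed.

Lemma mono_homogeneous I p x :
  homogeneous (gr A) p x -> homogeneous tgrading (p (+) mparity eps I) (mono I x).
Proof.
move=> hx; apply/thomogeneousP => i; rewrite ffunE /smono.
by case: eqP => [->|_]; [rewrite addbK | exact: homogeneous0].
Qed.

Lemma tsign_mono (b : bool) I x : (-1) ^+ b * mono I x = mono I ((-1) ^+ b * x).
Proof. by rewrite !mulr_sign; case: b; rewrite ?raddfN. Qed.

(** Sign exponents of graded commutativity for x t^I and y t^J, with [p], [q] the parities of x,
    y. *)
Lemma koszulC I J p q : admissible eps (I + J)%MM ->
  koszul I J q (+) (p && q) =
  ((p (+) mparity eps I) && (q (+) mparity eps J)) (+) koszul J I p.
Proof.
move=> adm; rewrite /koszul (swapsC adm).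
case: (odd _); case: (mparity _ I); case: (mparity _ J); case: p; case: q => //.
Qed.

Lemma tser_graded_comm : graded_comm tgrading.
Proof.
have [[h1 hM hC] _ _ _ _ _ _ _] := ABV; split.
- by have := mono_homogeneous 0%MM h1; rewrite mparity0.
- move=> p q F G /thomogeneousP hF /thomogeneousP hG.
  have hmono I r s x y : homogeneous (gr A) r x -> homogeneous (gr A) s y -> forall J,
      homogeneous tgrading ((r (+) mparity eps I) (+) (s (+) mparity eps J)) (mono I x * mono J y).
    move=> hx hy J; rewrite (mono_mul _ _ _ hy) addbACA -mparityD.
    by apply: mono_homogeneous; apply: homogeneous_sign; apply: hM.
  pattern F; apply: tser_coef_ind => [|F1 F2 h1' h2|i].
  + by rewrite mul0r; apply: homogeneous0.
  + by rewrite mulrDl; apply: homogeneousD.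
  pattern G; apply: tser_coef_ind => [|F1 F2 h1' h2|j].
  + by rewrite mulr0; apply: homogeneous0.
  + by rewrite mulrDr; apply: homogeneousD.
  by have := hmono (tmon i) _ _ _ _ (hF i) (hG j) (tmon j); rewrite !addbK.
move=> p q F G /thomogeneousP hF /thomogeneousP hG.
pattern F; apply: tser_coef_ind => [|F1 F2 h1' h2|i].
+ by rewrite mul0r !mulr0.
+ by rewrite mulrDl h1' h2 -mulrDr -mulrDr.
pattern G; apply: tser_coef_ind => [|F1 F2 h1' h2|j].
+ by rewrite mul0r !mulr0.
+ by rewrite mulrDr h1' h2 -mulrDr -mulrDl.
rewrite (mono_mul _ _ _ (hG j)) (mono_mul _ _ _ (hF i)) (addmC (tmon j)) tsign_mono.
(* If an odd variable is repeated, both products are 0. *)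
have [adm|nadm] := boolP (admissible eps (tmon i + tmon j)%MM); last first.
  by rewrite !mono_nonadm.
congr (mono _ _); rewrite (hC _ _ _ _ (hF i) (hG j)) !mulrA -!signr_addb.
by rewrite (koszulC _ _ adm) !addbK.
Qed.

Lemma koszul_odd I J r : koszul I J (~~ r) = koszul I J r (+) mparity eps I.
Proof. by rewrite /koszul; case: (odd _); case: mparity; case: r. Qed.

(** Compares, for coefficients of parities [p], [q], [r], the sign of the last term of the
    second-order identity taken with total parities to the one in [A]. *)
Lemma koszul_order2 I J K p q r : admissible eps (I + J)%MM ->
  ((~~ (p (+) mparity eps I) && (q (+) mparity eps J)) (+)
     (koszul I K r (+) koszul J (I + K)%MM (~~ (p (+) r)))) =
  (~~ p && q) (+) (koszul I J q (+) koszul (I + J)%MM K r).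
Proof.
move=> adm; rewrite /koszul !(swapsDl, swapsDr) mparityD !oddD (swapsC adm).
case: (odd (swaps _ I J)); case: (odd (swaps _ I K)); case: (odd (swaps _ J K)).
all: by case: (mparity _ I); case: (mparity _ J); case: p; case: q; case: r.
Qed.

(** Coefficients stand to the left of the variables, so [d] and [D] act on them without sign. The
    product identities reduce to monomials, where they are those of [A] up to Koszul signs. *)
Lemma tser_bv_structure : bv_structure tgrading (tmap (d A)) (tmap (D A)).
Proof.
have [[h1 hM hC] hD hd DD dd dD der o2] := ABV.
split=> [|p F|p F|F|F|F|p F G|p q F G H].
- exact: tser_graded_comm.
- move=> /thomogeneousP hF; apply/thomogeneousP => i.
  by rewrite ffunE addNb; apply: hD.
- move=> /thomogeneousP hF; apply/thomogeneousP => i.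
  by rewrite ffunE addNb; apply: hd.
- by apply/ffunP => i; rewrite !ffunE DD.
- by apply/ffunP => i; rewrite !ffunE dd.
- by apply/ffunP => i; rewrite !ffunE dD.
- move=> /thomogeneousP hF.
  pattern F; apply: tser_coef_ind => [|u v eu ev|i].
  + by rewrite raddf0 !mul0r raddf0 mulr0 addr0.
  + by rewrite mulrDl !raddfD /= eu ev !mulrDl mulrDr addrACA.
  pattern G; apply: tser_mono_ind => [|u v eu ev|J r y hy].
  + by rewrite raddf0 !mulr0 raddf0 addr0.
  + by rewrite mulrDr !raddfD /= eu ev !mulrDr addrACA.
  rewrite /= !tmap_mono !(mono_mul _ _ _ hy) (mono_mul _ _ _ (hd _ _ hy)) tmap_mono.
  rewrite tsign_mono -raddfD; congr (mono _ _).
  rewrite raddfMsign (der _ _ _ (hF i)) mulrDr; congr (_ + _).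
  rewrite !mulrA -!signr_addb koszul_odd; congr ((-1) ^+ (nat_of_bool _) * _ * _).
  by case: (mparity _ _); case: (koszul _ _ _); case: (p).
move=> /thomogeneousP hF /thomogeneousP hG DF DG DH.
have cl (X : tser) : tmap (D A) X = 0 -> forall i, D A (X i) = 0.
  by move=> /ffunP DX i; have := DX i; rewrite !ffunE.
pattern F; apply: tser_coef_ind => [|u v eu ev|i].
+ by rewrite !(raddf0, mul0r, mulr0) !addr0.
+ rewrite !(raddfD, mulrDl, mulrDr) /= eu ev.
  by rewrite [LHS]addrACA [X in X + _ = _]addrACA.
pattern G; apply: tser_coef_ind => [|u v eu ev|j].
+ by rewrite !(raddf0, mul0r, mulr0) !addr0.
+ rewrite !(raddfD, mulrDl, mulrDr) /= eu ev.
  by rewrite [LHS]addrACA [X in X + _ = _]addrACA.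
pattern H; apply: tser_coef_ind => [|u v eu ev|l].
+ by rewrite !(raddf0, mul0r, mulr0) !addr0.
+ rewrite !(raddfD, mulrDl, mulrDr) /= eu ev.
  by rewrite [LHS]addrACA [X in X + _ = _]addrACA.
move: (tmon i) (hF i) (cl _ DF i) (tmon j) (hG j) (cl _ DG j) (tmon l) (cl _ DH l).
move: (F i) (G j) (H l) => x y z I hx Dx J hy Dy K Dz.
(* The coefficient [z] may have no parity: the identity is shown for a homogeneous closed
   coefficient and then applied to the two parts of [z], which are closed since [D] is odd. *)
have main r z' : homogeneous (gr A) r z' -> D A z' = 0 ->
    tmap (D A) (mono I x * mono J y * mono K z') =
    tmap (D A) (mono I x * mono J y) * mono K z' +
    (-1) ^+ p * (mono I x * tmap (D A) (mono J y * mono K z')) +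
    (-1) ^+ (~~ p && q) * (mono J y * tmap (D A) (mono I x * mono K z')).
  move=> hz Dz'.
  have hyz := hD _ _ (homogeneous_sign (koszul J K r) (hM _ _ _ _ hy hz)).
  have hxz := hD _ _ (homogeneous_sign (koszul I K r) (hM _ _ _ _ hx hz)).
  rewrite !(mono_mul _ _ _ hz) !(mono_mul _ _ _ hy) !(mono_mul _ _ _ hz) /= !tmap_mono.
  rewrite !(mono_mul _ _ _ hz) (mono_mul _ _ _ hyz) (mono_mul _ _ _ hxz).
  rewrite !tsign_mono !addmA (addmC J I).
  have [adm|nadm] := boolP (admissible eps (I + J + K)%MM); last first.
    by rewrite !mono_nonadm // !addr0.
  have admIJ := admissible_addl adm.
  rewrite -!raddfD; congr (mono _ _).
  have sC (b : bool) (u v : A) : u * ((-1) ^+ b * v) = (-1) ^+ b * (u * v).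
    by rewrite !mulr_sign; case: b; rewrite ?mulrN.
  rewrite -[in LHS]mulrA !raddfMsign.
  rewrite (o2 _ _ _ _ _ hx hy Dx Dy Dz') !(sC _ x) !(sC _ y) !mulrDr.
  congr (_ + _ + _); first by rewrite -!mulrA.
    rewrite !mulrA -!signr_addb -!mulrA; congr ((-1) ^+ (nat_of_bool _) * _).
    rewrite koszul_odd; move: (koszulA I J K (q (+) mparity eps J) r).
    do 4 case: (koszul _ _ _); by case: (mparity _ I); case: (p).
  rewrite !mulrA -!signr_addb -!mulrA; congr ((-1) ^+ (nat_of_bool _) * _).
  have := koszul_order2 K (p (+) mparity eps I) (q (+) mparity eps J) r admIJ.
  rewrite !addbK; do 4 case: (koszul _ _ _);
  by case: (~~ p && q); case: (~~ _ && _).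
rewrite -(part_sum (gr A) z) !(raddfD, mulrDl, mulrDr) /=.
have Dp b : D A (part (gr A) b z) = 0.
  by rewrite -(negbK b) -(part_odd _ _ hD) Dz raddf0.
rewrite (main _ _ (homogeneous_part _ false _) (Dp _)).
rewrite (main _ _ (homogeneous_part _ true _) (Dp _)).
by rewrite [LHS]addrACA [X in X + _ = _]addrACA.
Qed.

(** * Coefficientwise functionals on the truncated ring *)

Section Functional.
Variables (V : zmodType) (f : {additive A -> V}).

Definition tfunctional (i : tindex) (F : tser) : V := f (F i).

Lemma tfunctional_zmod_morphism i : zmod_morphism (tfunctional i).
Proof. by move=> F G; rewrite /tfunctional !ffunE raddfB. Qed.

HB.instance Definition _ i :=
  GRing.isZmodMorphism.Build tser V (tfunctional i) (tfunctional_zmod_morphism i).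

(** The coefficient of t^I in [F] has parity [p] plus that of t^I; the extra sign is the one from
    moving the odd [D] past t^I. *)
Lemma tfunctional_D : (forall p x y, homogeneous (gr A) p x ->
    f (D A x * y) = f ((-1) ^+ p * (x * D A y))) ->
  forall i p F G, homogeneous tgrading p F ->
    tfunctional i (tmap (D A) F * G) = tfunctional i ((-1) ^+ p * (F * tmap (D A) G)).
Proof.
have [_ hD _ _ _ _ _ _] := ABV.
move=> fD i p F G /thomogeneousP hF.
pattern F; apply: tser_coef_ind => [|u v eu ev|j].
+ by rewrite !(raddf0, mul0r, mulr0).
+ by rewrite !(raddfD, mulrDl, mulrDr) /= eu ev.
pattern G; apply: tser_mono_ind => [|u v eu ev|J r y hy].
+ by rewrite !(raddf0, mul0r, mulr0).
+ by rewrite !(raddfD, mulrDl, mulrDr) /= eu ev.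
rewrite /= !tmap_mono !(mono_mul _ _ _ hy) (mono_mul _ _ _ (hD _ _ hy)) tsign_mono.
rewrite /tfunctional !ffunE /smono; case: ifP => // _.
have := fD _ _ y (hF j); rewrite koszul_odd !mulr_sign.
case: (p); case: (mparity _ _); case: (koszul _ _ _).
all: by rewrite /= ?opprK ?raddfN => ->; rewrite ?opprK.
Qed.

End Functional.

End Truncated.


(** * The gauge action on series *)

Section RationalScaling.
Variables (k : algType rat) (gk : grading k) (A : dgbvAlgebra gk).

Lemma qscale_nat m (x : A) : qscale m%:R x = x *+ m.
Proof. by rewrite /qscale !scaler_nat. Qed.

Lemma qscaleM p q (x : A) : qscale p (qscale q x) = qscale (p * q) x.
Proof. by rewrite /qscale scalerA -scalerAl mul1r scalerA. Qed.

Lemma qscale_is_additive p : zmod_morphism (qscale p : A -> A).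
Proof. by move=> x y; rewrite /qscale scalerBr. Qed.

HB.instance Definition _ p :=
  GRing.isZmodMorphism.Build A A (qscale p) (qscale_is_additive p).

Lemma qscale1 (x : A) : qscale 1 x = x.
Proof. by rewrite /qscale !scale1r. Qed.

Lemma dgbv_torsion_free : torsion_free A.
Proof.
move=> m x /(congr1 (qscale (m.+1%:R)^-1)).
by rewrite -qscale_nat qscaleM mulVf ?Num.Theory.pnatr_eq0 // qscale1 raddf0.
Qed.

Lemma qscale_divK m (x : A) : qscale (m.+1%:R)^-1 x *+ m.+1 = x.
Proof. by rewrite -qscale_nat qscaleM mulfV ?Num.Theory.pnatr_eq0 // qscale1. Qed.

Lemma torsion_freeP (V : zmodType) : torsion_free V ->
  forall m (x y : V), x *+ m.+1 = y *+ m.+1 -> x = y.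
Proof.
move=> V_tf m x y /eqP; rewrite -subr_eq0 -mulrnBl => /eqP/V_tf/eqP.
by rewrite subr_eq0 => /eqP.
Qed.

(** Multiplication by [m.+1] is injective on [A], so additive maps commute with division by it. *)
Lemma qscale_div_additive (f : {additive A -> A}) m x :
  f (qscale (m.+1%:R)^-1 x) = qscale (m.+1%:R)^-1 (f x).
Proof.
by apply: (torsion_freeP dgbv_torsion_free (m := m)); rewrite -raddfMn /= !qscale_divK.
Qed.

Lemma scalar_torsion_free : torsion_free (k^o : zmodType).
Proof.
move=> m x h.
have : (m.+1%:R^-1 : rat) *: ((x : k) *+ m.+1) = 0.
  by rewrite -[RHS](scaler0 _ (m.+1%:R^-1)) -[in RHS]h.
by rewrite -scaler_nat scalerA mulVf ?Num.Theory.pnatr_eq0 // scale1r.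
Qed.

End RationalScaling.

(** * The bracket on [D]-closed series and the locality of the gauge action *)

Section SeriesBracket.
Variables (k : algType rat) (gk : grading k) (A : dgbvAlgebra gk) (n : nat).
Variable eps : 'I_n -> bool.
Implicit Types F G S w : series n A.

Definition closed_series F : Prop := forall m, D A (F m) = 0.

(** The coefficient of t^I has parity [p] plus that of t^I, and the second sign is cancelled by the
    odd bracket symbol passing t^I. *)
Lemma sbracket_closed p F w : series_parity eps p F ->
  closed_series F -> closed_series w ->
  forall m, sbracket eps F w m = (-1) ^+ p * D A (smul eps F w m).
Proof.
have [_ hD _ _ _ _ _ _] := dgbv_bv_structure A.
move=> hF DF Dw m; rewrite /sbracket /smul /kext; case: ifP => _; last by rewrite raddf0 mulr0.
rewrite raddf_sum mulr_sumr; apply: eq_bigr => -[I J] _ /=.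
rewrite raddf_sum mulr_sumr; apply: eq_bigr => r _ /=.
have Dwr : D A (part (gr A) r (w J)) = 0.
  by rewrite -(negbK r) -(part_odd _ _ hD) Dw raddf0.
rewrite (bv_bracket_closed _ (hF I) (DF I)) Dwr mulr0 subr0 !raddfMsign.
rewrite -(signr_odd _ (swaps _ _ _)) !mulrA -!signr_addb; congr ((-1) ^+ (nat_of_bool _) * _).
by case: (odd _); case: (mparity _ _); case: (p); case: (r).
Qed.


Lemma sbracket_local F F' w w' M m :
  F 0%MM = 0 -> F' 0%MM = 0 -> w 0%MM = 0 -> w' 0%MM = 0 ->
  (forall I, (mdeg I < M)%N -> F I = F' I) ->
  (forall I, (mdeg I < M)%N -> w I = w' I) -> (mdeg m <= M)%N ->
  sbracket eps F w m = sbracket eps F' w' m.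
Proof. by apply: kext_local_lt; [exact: bv_bracket0l | exact: bv_bracket0r]. Qed.

Lemma smul_local F F' w w' M m :
  F 0%MM = 0 -> F' 0%MM = 0 -> w 0%MM = 0 -> w' 0%MM = 0 ->
  (forall I, (mdeg I < M)%N -> F I = F' I) ->
  (forall I, (mdeg I < M)%N -> w I = w' I) -> (mdeg m <= M)%N ->
  smul eps F w m = smul eps F' w' m.
Proof. by apply: kext_local_lt => x; rewrite ?mul0r ?mulr0. Qed.

Lemma iter_sbracket0 S w q : S 0%MM = 0 -> w 0%MM = 0 ->
  iter q (sbracket eps S) w 0%MM = 0.
Proof.
move=> S0 w0; case: q => [//|q].
by apply: iter_ad_small => //; rewrite mdeg0.
Qed.

(** A bracket with [S] raises the order, so after at least one of them agreement below [M] extends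
    to order [M]. *)
Lemma iter_sbracket_local S S' w w' M :
  S 0%MM = 0 -> S' 0%MM = 0 -> w 0%MM = 0 -> w' 0%MM = 0 ->
  (forall I, (mdeg I < M)%N -> S I = S' I) ->
  (forall I, (mdeg I < M)%N -> w I = w' I) ->
  forall q m, (mdeg m < M + (q != 0%N))%N ->
  iter q (sbracket eps S) w m = iter q (sbracket eps S') w' m.
Proof.
move=> S0 S'0 w0 w'0 eqS eqw; elim=> [|q IHq] m; first by rewrite addn0; apply: eqw.
rewrite addn1 ltnS => le_mM /=.
apply: (@sbracket_local _ _ _ _ M) => //; try exact: iter_sbracket0.
by move=> I ltI; apply: IHq; apply: leq_trans ltI (leq_addr _ _).
Qed.

(** Apart from [- d (S m)], the terms that contain [S] involve a bracket of series without constant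
    term, hence see only lower orders of [S]. *)
Lemma gauge_local S S' F m :
  S 0%MM = 0 -> S' 0%MM = 0 -> F 0%MM = 0 ->
  (forall I, (mdeg I < mdeg m)%N -> S I = S' I) ->
  gauge eps S F m + d A (S m) = gauge eps S' F m + d A (S' m).
Proof.
move=> S0 S'0 F0 eqS; rewrite /gauge -!addrA; congr (_ + _).
  apply: eq_bigr => q _; congr (qscale _ _); case: (val q) => [//|q'].
  by apply: (@iter_sbracket_local _ _ _ _ (mdeg m)) => //; rewrite addn1.
rewrite !big_ord_recl /= (_ : (1`!)%:R^-1 = 1 :> rat) // !qscale1 !opprD.
rewrite !(addrAC _ _ (d A _)) /sd !addNr !add0r; congr (- _).
apply: eq_bigr => q _; congr (qscale _ _).
apply: (@iter_sbracket_local S S' (sd S) (sd S') (mdeg m) _ _ _ _ _ _ q.+1).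
all: by rewrite /sd ?S0 ?S'0 ?raddf0 ?addn1 // => I /eqS ->.
Qed.

End SeriesBracket.


(** * The curve e^{sS} . F as a polynomial in s *)

Section GaugeFlow.
Variables (k : algType rat) (gk : grading k) (A : dgbvAlgebra gk) (n : nat).
Variables (eps : 'I_n -> bool) (N : nat).

Local Notation tser := (tser A eps N).
Local Notation trunc := (@trunc k gk A n eps N).

Lemma tser_torsion_free : torsion_free tser.
Proof.
move=> m F /ffunP h; apply/ffunP => i; have := h i.
by rewrite ffunMnE !ffunE => /dgbv_torsion_free.
Qed.

Lemma trunc_sbracket p F w : series_parity eps p F ->
  closed_series F -> closed_series w ->
  trunc (sbracket eps F w) = (-1) ^+ p * tmap (D A) (trunc F * trunc w).
Proof.
move=> hF DF Dw; rewrite -trunc_mul; apply/ffunP => i.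
by rewrite mulr_sign; case: p hF => hF; rewrite !ffunE (sbracket_closed hF) // mulr_sign.
Qed.

Variables (S F : series n A).
Hypotheses (S_odd : series_parity eps true S) (S_closed : closed_series S) (S0 : S 0%MM = 0).
Hypotheses (F_even : series_parity eps false F) (F_closed : closed_series F) (F0 : F 0%MM = 0).

Let s : tser := trunc S.
Let f : tser := trunc F.
(** The operator ad_S on [D]-closed series, read modulo order > N. *)
Let L (x : tser) : tser := - tmap (D A) (s * x).
Let TBV := tser_bv_structure A eps N.

Let s_odd : homogeneous (tgrading A eps N) true s.
Proof. by apply/thomogeneousP => i; rewrite ffunE; apply: S_odd. Qed.

Let f_even : homogeneous (tgrading A eps N) false f.
Proof. by apply/thomogeneousP => i; rewrite ffunE; apply: F_even. Qed.

Let Df : tmap (D A) f = 0.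
Proof. by apply/ffunP => i; rewrite !ffunE F_closed. Qed.

Let LB : zmod_morphism L.
Proof. by move=> x y; rewrite /L mulrBr raddfB opprD. Qed.

HB.instance Definition _ := GRing.isZmodMorphism.Build tser tser L LB.

Lemma sd_closed : closed_series (sd S).
Proof.
by move=> m; have /eqP := dD_anti (S m); rewrite S_closed raddf0 add0r => /eqP.
Qed.

Let iterL w : closed_series w -> forall q,
  closed_series (iter q (sbracket eps S) w) /\
  trunc (iter q (sbracket eps S) w) = iter q L (trunc w).
Proof.
move=> Dw; elim=> [//|q [clq IHq]] /=; split=> [m|].
  by rewrite (sbracket_closed S_odd) // raddfMsign D_sq mulr0.
by rewrite (trunc_sbracket S_odd) // expr1 mulN1r IHq.
Qed.

Let iterL_small w q : closed_series w -> (N < q)%N -> iter q L (trunc w) = 0.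
Proof.
move=> Dw ltNq; have [_ <-] := iterL Dw q; apply/ffunP => i; rewrite !ffunE.
by apply: iter_ad_small => //; apply: leq_ltn_trans ltNq; apply: tmon_mdeg.
Qed.

Definition tdiv (m : nat) (x : tser) : tser := tmap (qscale (m%:R)^-1) x.

Lemma tdivK m x : (0 < m)%N -> tdiv m x *+ m = x.
Proof.
by case: m => // m _; apply/ffunP => i; rewrite ffunMnE !ffunE qscale_divK.
Qed.

(** This is q! times the coefficient of s^q: replacing S by sS gives ad_S^q' (d S) / (q'+1)! the
    power s^(q'+1), whence the shifted index. *)
Let u q : tser := iter q L f - (if q is q'.+1 then iter q' L (trunc (sd S)) else 0).

Let uS q : u q.+1 = L (u q) - (if q == 0%N then trunc (sd S) else 0).
Proof.
by case: q => [|q]; rewrite /u raddfB /= ?subr0 // raddf0 subr0.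
Qed.

Let u_even_closed q : homogeneous (tgrading A eps N) false (u q) /\ tmap (D A) (u q) = 0.
Proof.
elim: q => [|q [hq Dq]]; first by rewrite /u subr0.
have hsd : homogeneous (tgrading A eps N) false (trunc (sd S)).
  have -> : trunc (sd S) = tmap (d A) s by apply/ffunP => i; rewrite !ffunE.
  exact: (homogeneous_d TBV s_odd).
have Dsd : tmap (D A) (trunc (sd S)) = 0.
  by apply/ffunP => i; rewrite !ffunE sd_closed.
rewrite uS; split.
  apply: homogeneousD; first exact: (homogeneousN (homogeneous_D TBV (homogeneousM TBV s_odd hq))).
  by apply: homogeneousN; case: eqP => _ //; exact: homogeneous0.
rewrite raddfB /= /L raddfN /= (bv_DD TBV) oppr0 sub0r.
by case: eqP => _; rewrite ?Dsd ?raddf0 ?oppr0.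
Qed.

(** The terms in [d S] lag one bracket behind, so vanishing starts only at N + 2, the size bound of
    [gauge_curve]. *)
Let u_small q : (N.+1 < q)%N -> u q = 0.
Proof.
case: q => // q; rewrite ltnS => ltNq.
rewrite /u (iterL_small F_closed) ?(iterL_small sd_closed) ?subr0 //.
exact: ltnW.
Qed.

(* The curve s |-> e^{sS} . F modulo order > N, as a polynomial in s. *)
Definition gauge_curve : {poly tser} := \poly_(q < N.+2) tdiv q`! (u q).

Lemma gauge_curve_coef q : gauge_curve`_q = tdiv q`! (u q).
Proof.
rewrite coef_poly; case: ltnP => // leNq.
by rewrite u_small // /tdiv raddf0.
Qed.

Lemma gauge_curve_even q : homogeneous (tgrading A eps N) false gauge_curve`_q.
Proof.
have [/thomogeneousP hq _] := u_even_closed q.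
rewrite gauge_curve_coef; apply/thomogeneousP => i; rewrite ffunE.
case: q`! (fact_gt0 q) => // m _.
by rewrite /homogeneous qscale_div_additive; congr (qscale _ _); apply: hq.
Qed.

Lemma gauge_curve_closed q : tmap (D A) gauge_curve`_q = 0.
Proof.
have [_ /ffunP Dq] := u_even_closed q.
rewrite gauge_curve_coef; apply/ffunP => i; have := Dq i; rewrite !ffunE => Dqi.
case: q`! (fact_gt0 q) => // m _.
by rewrite qscale_div_additive Dqi raddf0.
Qed.

(** Multiplied by q!, the coefficient of s^q is the recursion [uS]; the constant [d s] enters at q =
    0 only. *)
Lemma gauge_curve_flow :
  gauge_curve^`() = - map_poly (tmap (D A)) (s%:P * gauge_curve) - (tmap (d A) s)%:P.
Proof.
have sdE : trunc (sd S) = tmap (d A) s by apply/ffunP => i; rewrite !ffunE.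
apply/polyP => q; rewrite coef_deriv coefB coefN coef_map coefCM coefC.
rewrite -[- _]/(L _) !gauge_curve_coef.
case E : q`! (fact_gt0 q) => [//|m] _.
apply: (torsion_freeP tser_torsion_free (m := m)).
rewrite -mulrnA -E -factS (tdivK _ (fact_gt0 _)) mulrnBl -raddfMn /= (tdivK _ (fact_gt0 _)).
by rewrite uS sdE; case: eqP E => [->|_ _]; rewrite ?mul0rn.
Qed.

Lemma gauge_curve0 : gauge_curve`_0 = f.
Proof.
by rewrite gauge_curve_coef -[LHS]/(tdiv 1 (u 0) *+ 1) tdivK // /u subr0.
Qed.

Lemma gauge_curve1 : gauge_curve.[1] = trunc (gauge eps S F).
Proof.
rewrite (horner_coef_wide _ (size_poly _ _)).
(* The sums in [gauge] stop at the order of the monomial; the terms added up to a common bound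
   vanish by [iter_ad_small]. *)
have widen (a b : nat) (h : nat -> A) : (a <= b)%N ->
    (forall q, (a <= q)%N -> h q = 0) -> \sum_(q < b) h q = \sum_(q < a) h q.
  move=> le_ab h0; rewrite (big_ord_widen _ _ le_ab) [LHS](bigID (fun q : 'I_b => (q < a)%N)) /=.
  by rewrite [X in _ + X]big1 ?addr0 // => q; rewrite -leqNgt => /h0.
apply/ffunP => i; rewrite !ffunE sum_ffunE.
have tE q w : closed_series w -> iter q L (trunc w) i = iter q (sbracket eps S) w (tmon i).
  by move=> Dw; have [_ <-] := iterL Dw q; rewrite ffunE.
pose h1 q := qscale (q`!%:R)^-1 (iter q (sbracket eps S) F (tmon i)).
pose h2 q := qscale (q.+1`!%:R)^-1 (iter q (sbracket eps S) (sd S) (tmon i)).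
rewrite /gauge -[X in _ = X - _](widen _ N.+2 h1); last 2 first.
- by rewrite ltnS; apply: leqW (tmon_mdeg i).
- by move=> q lt_q; rewrite /h1 iter_ad_small ?raddf0.
rewrite -[X in _ = _ - X](widen _ N.+1 h2); last 2 first.
- by rewrite ltnS; apply: tmon_mdeg.
- by move=> q lt_q; rewrite /h2 iter_ad_small ?raddf0.
transitivity (\sum_(q < N.+2) (qscale (q`!%:R)^-1 (iter q (sbracket eps S) F (tmon i)) -
   (if nat_of_ord q is q'.+1
    then qscale (q`!%:R)^-1 (iter q' (sbracket eps S) (sd S) (tmon i)) else 0))).
  apply: eq_bigr => q _; rewrite expr1n mulr1 gauge_curve_coef !ffunE raddfB (tE _ _ F_closed).
  congr (_ - _); case: (nat_of_ord q) => [|q']; first by rewrite ffunE raddf0.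
  by rewrite (tE _ _ sd_closed).
by rewrite sumrB; congr (_ - _); rewrite big_ord_recl add0r.
Qed.

End GaugeFlow.


(** * Effect of a gauge transformation on parity, low orders, curvature and potential *)

Section GaugeProperties.
Variables (k : algType rat) (gk : grading k) (A : dgbvAlgebra gk) (n : nat).
Variable eps : 'I_n -> bool.

Lemma mc_double (F : series n A) : series_parity eps false F -> closed_series F ->
  maurer_cartan eps F -> forall m, d A (F m) *+ 2 + D A (smul eps F F m) = 0.
Proof.
move=> hF DF mc m; have /(congr1 (fun x => x *+ 2)) := mc m.
by rewrite mulrnDl mul0rn div1r qscale_divK (sbracket_closed hF) // expr0 mul1r.
Qed.

Variables (S F : series n A).
Hypotheses (S_odd : series_parity eps true S) (S_closed : closed_series S) (S0 : S 0%MM = 0).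
Hypotheses (F_even : series_parity eps false F) (F_closed : closed_series F) (F0 : F 0%MM = 0).
Hypotheses (S_super : superseries eps S) (F_super : superseries eps F).

Lemma gauge_super : superseries eps (gauge eps S F).
Proof.
move=> m nadm.
have it0 w q : superseries eps w -> iter q (sbracket eps S) w m = 0.
  move=> w_super; case: q => [|q] /=; first exact: w_super.
  by rewrite /sbracket /kext (negPf nadm).
rewrite /gauge !big1 ?subr0 // => q _; rewrite it0 ?raddf0 //.
by move=> m' /S_super; rewrite /sd => ->; rewrite raddf0.
Qed.

Lemma gauge_order0 : gauge eps S F 0%MM = 0.
Proof.
rewrite /gauge !big1 ?subr0 // => q _.
  by rewrite iter_sbracket0 ?raddf0 // /sd S0 raddf0.
by rewrite iter_sbracket0 // raddf0.
Qed.

(** Below order 1 there is only the constant term of [S], which is 0; so [gauge_local] compares [S]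
    with the zero series, which leaves [F m] unchanged. *)
Lemma gauge_order1 m : mdeg m = 1%N -> gauge eps S F m = F m - d A (S m).
Proof.
move=> m1; have := @gauge_local _ _ A _ eps S (fun=> 0) F m S0 erefl F0.
rewrite raddf0 addr0 => e; apply/eqP; rewrite eq_sym subr_eq e; last first.
  by move=> I; rewrite m1 ltnS leqn0 mdeg_eq0 => /eqP ->.
have br0 w : sbracket eps (fun=> 0) w m = 0.
  rewrite /sbracket /kext; case: ifP => // _; rewrite big1 // => IJ _.
  by rewrite big1 // => r _; rewrite bv_bracket0l !mulr0.
rewrite /gauge [X in _ == _ - X]big1 => [|[[|q] ?] _] /=; last first.
- by rewrite br0 raddf0.
- by rewrite /sd !raddf0.
rewrite subr0 big_ord_recl big1 => [|q _] /=; last by rewrite br0 raddf0.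
by rewrite (_ : (0`!)%:R^-1 = 1 :> rat) // qscale1 addr0.
Qed.

Lemma gauge_even : series_parity eps false (gauge eps S F).
Proof.
move=> m; have [adm|/gauge_super ->] := boolP (admissible eps m); last exact: homogeneous0.
have [i mE] := tmonP adm (leqnn (mdeg m)).
have : homogeneous (tgrading A eps (mdeg m)) false (trunc eps (mdeg m) (gauge eps S F)).
  rewrite -gauge_curve1 // horner1_coef; apply: big_ind => [|x y|q _].
  - exact: homogeneous0.
  - exact: homogeneousD.
  - exact: gauge_curve_even.
by move=> /thomogeneousP/(_ i); rewrite ffunE mE.
Qed.

Hypothesis F_mc : forall m, d A (F m) *+ 2 + D A (smul eps F F m) = 0.

Let trunc_mc N : tmap (d A) (trunc eps N F) *+ 2
  + tmap (D A) (trunc eps N F * trunc eps N F) = 0.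
Proof. by rewrite -trunc_mul; apply/ffunP => i; rewrite ffunE ffunMnE !ffunE F_mc. Qed.

Let trunc_odd N : homogeneous (tgrading A eps N) true (trunc eps N S).
Proof. by apply/thomogeneousP => i; rewrite ffunE; apply: S_odd. Qed.

Let trunc_closed N : tmap (D A) (trunc eps N S) = 0.
Proof. by apply/ffunP => i; rewrite !ffunE S_closed. Qed.

Lemma gauge_mc m : admissible eps m ->
  d A (gauge eps S F m) *+ 2 + D A (smul eps (gauge eps S F) (gauge eps S F) m) = 0.
Proof.
move=> adm; have [i mE] := tmonP adm (leqnn (mdeg m)).
have := flow_end_curvature (tser_bv_structure A eps (mdeg m))
  (@tser_torsion_free _ _ _ _ _ _) (trunc_odd _) (trunc_closed _)
  (gauge_curve_even (mdeg m) S_odd S_closed S0 F_even F_closed)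
  (gauge_curve_closed (mdeg m) S_odd S_closed S0 F_even F_closed)
  (gauge_curve_flow (mdeg m) S_odd S_closed S0 F_closed).
rewrite gauge_curve0 // gauge_curve1 // => /(_ (trunc_mc _)).
rewrite -trunc_mul => /ffunP/(_ i).
by rewrite ffunE ffunMnE !ffunE mE.
Qed.

Hypothesis F_linear : forall m, mdeg m = 1%N -> d A (F m) = 0.
Variables (I : {additive A -> k^o}).
Hypothesis I_d : forall x, I (d A x) = 0.
Hypothesis I_D : forall p x y, homogeneous (gr A) p x ->
  I (D A x * y) = I ((-1) ^+ p * (x * D A y)).

(* 12 (G^3 / 6 - (G - G_1) G^2 / 4) = 3 G_1 G^2 - G^3 *)
Lemma potential12 (G : series n A) N (i : tindex eps N) :
  let g := trunc eps N G in let g1 := trunc eps N (first_order G) in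
  potential eps I G (tmon i) *+ 12 =
  tfunctional I i ((g1 * (g * g)) *+ 3 - g * (g * g)).
Proof.
move=> g g1.
have cubeE : smul eps G (smul eps G G) (tmon i) = (g * (g * g)) i.
  by rewrite /g -!trunc_mul ffunE.
have diffE : smul eps (fun m' => G m' - first_order G m') (smul eps G G) (tmon i)
    = ((g - g1) * (g * g)) i.
  rewrite -[g - g1](_ : trunc eps N (fun m' => G m' - first_order G m') = _).
    by rewrite /g -!trunc_mul ffunE.
  by apply/ffunP => j; rewrite !ffunE.
rewrite /potential cubeE diffE -raddfMn /tfunctional; congr (I _).
rewrite mulrBl; move: (g * (g * g)) (g1 * (g * g)) => u v.
rewrite [(u - v) i]ffunE [(- v) i]ffunE [(v *+ 3 - u) i]ffunE ffunMnE [(- u) i]ffunE.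
rewrite mulrnBl (mulrnA _ 6 2) (mulrnA _ 4 3) !div1r !qscale_divK.
by rewrite mulrnBl opprB addrCA; congr (_ + _); rewrite (mulrSr (u i) 2) opprD addrA subrr add0r.
Qed.

Lemma gauge_potential m : potential eps I (gauge eps S F) m = potential eps I F m.
Proof.
have [adm|nadm] := boolP (admissible eps m); last first.
  have z (X Y : series n A) : smul eps X Y m = 0 by rewrite /smul /kext (negPf nadm).
  by rewrite /potential !z.
have [i mE] := tmonP adm (leqnn (mdeg m)); set N := mdeg m in i mE.
(* The factor cancelled is [m.+1], here the 12 of [potential12]. *)
apply: (torsion_freeP (@scalar_torsion_free _) (m := 11)).
rewrite -mE !potential12.
pose f1 := trunc eps N (first_order F); pose s1 := trunc eps N (first_order S).
(* The linear part of e^{sS} . F is F_1 - s d S_1; thus [s1] takes the role of [b] in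
   [flow_potential]. *)
pose y : {poly tser A eps N} := f1%:P - (tmap (d A) s1)%:P * 'X.
have first_odd : homogeneous (tgrading A eps N) true s1.
  apply/thomogeneousP => j; rewrite ffunE /first_order; case: eqP => _; last exact: homogeneous0.
  exact: S_odd.
have first_even : homogeneous (tgrading A eps N) false f1.
  apply/thomogeneousP => j; rewrite ffunE /first_order; case: eqP => _; last exact: homogeneous0.
  exact: F_even.
have Ds1 : tmap (D A) s1 = 0.
  by apply/ffunP => j; rewrite !ffunE /first_order; case: eqP => _; rewrite ?S_closed ?raddf0.
have Df1 : tmap (D A) f1 = 0.
  by apply/ffunP => j; rewrite !ffunE /first_order; case: eqP => _; rewrite ?F_closed ?raddf0.
have df1 : tmap (d A) f1 = 0.
  apply/ffunP => j; rewrite !ffunE /first_order; case: eqP => [/F_linear ->|_] //.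
  by rewrite raddf0.
have yE q : y`_q = if q is q'.+1 then if q' is 0%N then - tmap (d A) s1 else 0 else f1.
  rewrite coefB coefC coefMX coefC.
  by case: q => [|[|q]] /=; rewrite ?subr0 ?sub0r.
have y1 : y.[1] = trunc eps N (first_order (gauge eps S F)).
  rewrite /y hornerD hornerN hornerMX !hornerC mulr1; apply/ffunP => j.
  rewrite !ffunE /first_order; case: eqP => [m1|_]; last by rewrite raddf0 subr0.
  by rewrite gauge_order1.
have TBV := tser_bv_structure A eps N.
have := flow_potential TBV (@tser_torsion_free _ _ _ _ _ _) (trunc_odd _) (trunc_closed _)
  (gauge_curve_even N S_odd S_closed S0 F_even F_closed)
  (gauge_curve_closed N S_odd S_closed S0 F_even F_closed)
  (gauge_curve_flow N S_odd S_closed S0 F_closed) _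
  (b := s1) (y := y) first_odd Ds1 _ _ _ _ (J := tfunctional I i) (@scalar_torsion_free _) _ _.
rewrite yE y1 gauge_curve0 // gauge_curve1 // => ->; first last.
- by move=> p u v hu; apply: tfunctional_D.
- move=> u; rewrite -[LHS]/(I (tmap (d A) u i)). by rewrite ffunE I_d.
- by rewrite /y derivB derivM !derivC derivX mul0r !add0r mulr1.
- case=> [|[|q]]; rewrite yE ?raddf0 //.
  by rewrite raddfN /= (bv_dd TBV) oppr0.
- case=> [|[|q]]; rewrite yE ?raddf0 //.
  by rewrite raddfN /= -(bv_dD TBV) /= Ds1 raddf0.
- case=> [|[|q]]; rewrite yE //; last exact: homogeneous0.
  exact: (homogeneousN (homogeneous_d TBV first_odd)).
- exact: trunc_mc.
by [].
Qed.

End GaugeProperties.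


(** * Gauge equivalence of universal solutions *)

Section Solutions.
Variables (k : algType rat) (gk : grading k) (A : dgbvAlgebra gk) (n : nat).
Variables (eps : 'I_n.+1 -> bool) (e : 'I_n.+1 -> homology A).

Lemma represents_closed (a : A) u : represents a u -> d A a = 0.
Proof. by move=> [[z dz] /= <- _]; apply/eqP. Qed.

Lemma usol_closed (F : series n.+1 A) : universal_solution eps e F -> closed_series F.
Proof.
move=> uF m; case: (ltngtP (mdeg m) 1) => [|lt1m|/eqP/mdeg1P[i /eqP ->]].
- by rewrite ltnS leqn0 mdeg_eq0 => /eqP ->; rewrite (usol_order0 uF) raddf0.
- by have [b _ <-] := usol_higher uF lt1m; apply: D_sq.
- by have [] := usol_order1 uF i.
Qed.

Lemma usol_linear (F : series n.+1 A) : universal_solution eps e F ->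
  forall m, mdeg m = 1%N -> d A (F m) = 0.
Proof.
move=> uF m /eqP/mdeg1P[i /eqP ->].
by have [_ /represents_closed] := usol_order1 uF i.
Qed.

Lemma odd_parameter_closed (S : series n.+1 A) : odd_parameter eps S -> closed_series S.
Proof. by move=> pS m; have [b _ <-] := odd_param_imD pS m; apply: D_sq. Qed.

Lemma imD_add x y : range (D A) x -> range (D A) y -> range (D A) (x + y).
Proof. by move=> [a _ <-] [b _ <-]; exists (a + b); rewrite ?raddfD. Qed.

Lemma imD_opp x : range (D A) x -> range (D A) (- x).
Proof. by move=> [a _ <-]; exists (- a); rewrite ?raddfN. Qed.

Lemma imD0 : range (D A) 0.
Proof. by exists 0; rewrite ?raddf0. Qed.

Lemma imD_qscale_fact q x : range (D A) x -> range (D A) (qscale (q`!%:R)^-1 x).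
Proof.
move=> [a _ <-]; case: q`! (fact_gt0 q) => // m _.
by exists (qscale (m.+1%:R)^-1 a); rewrite // qscale_div_additive.
Qed.

(** Brackets of [S] with closed series are [D]-exact, [d (S m)] is so because [d] and [D]
    anticommute, and [F m] is so in orders above 1. *)
Lemma gauge_imD (S F : series n.+1 A) : universal_solution eps e F -> odd_parameter eps S ->
  forall m, (1 < mdeg m)%N -> range (D A) (gauge eps S F m).
Proof.
move=> uF pS m lt1m.
have DS := odd_parameter_closed pS; have S_odd := odd_param_odd pS.
have sb w : closed_series w -> forall q,
    closed_series (iter q (sbracket eps S) w) /\
    ((0 < q)%N -> range (D A) (iter q (sbracket eps S) w m)).
  move=> Dw; elim=> [//|q [Dq _]] /=.
  have E := sbracket_closed S_odd DS Dq.
  split=> [m'|_]; first by rewrite E raddfMsign D_sq mulr0.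
  by rewrite E mulr_sign; apply: imD_opp; exists (smul eps S (iter q (sbracket eps S) w) m).
have sS : range (D A) (sd S m).
  rewrite /sd; have [b _ <-] := odd_param_imD pS m; exists (- d A b) => //.
  by rewrite raddfN; apply/esym/eqP; rewrite -addr_eq0 dD_anti.
apply: imD_add; last apply: imD_opp.
  apply: big_ind => [|x y|q _]; [exact: imD0|exact: imD_add|].
  apply: imD_qscale_fact; have [_ h] := sb _ (usol_closed uF) q.
  by case: (nat_of_ord q) h => [_|q' h]; [exact: usol_higher uF _ lt1m|exact: h].
apply: big_ind => [|x y|q _]; [exact: imD0|exact: imD_add|].
apply: imD_qscale_fact; have [_ h] := sb _ (sd_closed DS) q.
by case: (nat_of_ord q) h => [_|q' h]; [exact: sS|exact: h].
Qed.

Lemma zero_odd_parameter : odd_parameter eps (fun=> 0 : A).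
Proof. by split=> // m; [exact: homogeneous0|exact: imD0]. Qed.

Hypothesis A_dD : dD_condition A.
Variables F G : series n.+1 A.
Hypotheses (uF : universal_solution eps e F) (uG : universal_solution eps e G).

Lemma imdD_closed x : range (D A) x -> d A x = 0 -> exists c, d A (D A c) = x.
Proof.
move=> xD dx; have [_ h] := A_dD.
have : (range (d A \o D A)) x by rewrite h; split.
by case=> c _ <-; exists c.
Qed.

Lemma imdD_exact x : range (d A) x -> D A x = 0 -> exists c, d A (D A c) = x.
Proof.
move=> xd Dx; have [h _] := A_dD.
have : (range (d A \o D A)) x by rewrite h; split.
by case=> c _ <-; exists c.
Qed.

(** The default 0 is taken only if no preimage exists, a case excluded by [gauge_obstruction] where
    the value matters. *)
Definition dD_preimage (x : A) : A := xget 0 [set c | d A (D A c) = x]%classic.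

(** The new coefficient D c contributes - d (D c) to order [N], which removes the error if order [N]
    of [S] was 0. Projecting c to the parity of t^m makes the term D c t^m odd. *)
Definition gauge_step (N : nat) (S : series n.+1 A) : series n.+1 A := fun m =>
  if (mdeg m == N) && admissible eps m then
    D A (part (gr A) (mparity eps m) (dD_preimage (gauge eps S F m - G m)))
  else S m.

(* Only order [N] of [gauge eps S F] sees order [N] of [S], through [- d (S m)]
   (see [gauge_local]), so no Baker-Campbell-Hausdorff formula is needed. *)
Fixpoint gauge_approx (N : nat) : series n.+1 A :=
  if N is N'.+1 then gauge_step N (gauge_approx N') else fun=> 0.

Lemma gauge_step_param N S : odd_parameter eps S -> odd_parameter eps (gauge_step N.+1 S).
Proof.
move=> pS; have [_ hD _] := D_odd A; rewrite /gauge_step; split=> [m nadm|m|m|].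
- by rewrite (negPf nadm) andbF; apply: odd_param_super pS _ nadm.
- case: ifP => _; last exact: odd_param_odd pS m.
  by apply: hD; apply: homogeneous_part.
- case: ifP => _; last exact: odd_param_imD pS m.
  by eexists.
- by rewrite mdeg0; apply: odd_param_order0 pS.
Qed.

Lemma gauge_approx_param N : odd_parameter eps (gauge_approx N).
Proof. by elim: N => [|N IHN]; [exact: zero_odd_parameter|exact: gauge_step_param]. Qed.

Lemma gauge_approx_stable M N m : (mdeg m <= N)%N -> (N <= M)%N ->
  gauge_approx M m = gauge_approx N m.
Proof.
move=> le_mN; elim: M => [|M IHM]; first by rewrite leqn0 => /eqP ->.
rewrite leq_eqVlt => /predU1P[-> //|le_NM] /=.
rewrite /gauge_step ltn_eqF ?IHM //; exact: leq_ltn_trans le_mN le_NM.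
Qed.

Lemma gauge_approx_high N m : (N < mdeg m)%N -> gauge_approx N m = 0.
Proof.
elim: N => [//|N IHN] lt_Nm /=; rewrite /gauge_step gtn_eqF ?IHN //.
exact: ltnW.
Qed.

(* In order 1 the difference is d-exact and D-closed; in higher orders it is
   D-exact, and d-closed by the Maurer-Cartan equations in lower order. *)
Lemma gauge_obstruction S m : odd_parameter eps S -> (0 < mdeg m)%N ->
  (forall I, (mdeg I < mdeg m)%N -> gauge eps S F I = G I) ->
  (mdeg m = 1%N -> S m = 0) -> admissible eps m ->
  exists c, d A (D A c) = gauge eps S F m - G m.
Proof.
move=> pS m_gt0 eqFG S1 adm.
have S_odd := odd_param_odd pS; have DS := odd_parameter_closed pS.
have S0 := odd_param_order0 pS.
have F_even := usol_even uF; have DF := usol_closed uF; have F0 := usol_order0 uF.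
have F_mc := mc_double F_even DF (usol_mc uF).
have G_mc := mc_double (usol_even uG) (usol_closed uG) (usol_mc uG).
have [lt1m|le_m1] := ltnP 1 (mdeg m).
  apply: imdD_closed.
    apply: imD_add; first exact: gauge_imD.
    by apply: imD_opp; apply: usol_higher uG _ lt1m.
  (* Lower orders agree and constant terms vanish, so the quadratic terms agree at [m]; subtracting
     the two Maurer-Cartan equations shows that the difference is [d]-closed. *)
  have smulE : smul eps (gauge eps S F) (gauge eps S F) m = smul eps G G m.
    by apply: (@smul_local _ _ _ _ _ _ _ _ _ (mdeg m)); rewrite ?(usol_order0 uG) ?gauge_order0.
  apply: (torsion_freeP (@dgbv_torsion_free _ _ A) (m := 1)).
  rewrite mul0rn raddfB mulrnBl /=; apply/eqP; rewrite subr_eq0; apply/eqP.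
  apply: (addIr (D A (smul eps G G m))); rewrite G_mc -smulE.
  exact: (gauge_mc S_odd DS S0 F_even DF F_mc adm).
have m1 : mdeg m = 1%N by apply/eqP; rewrite eqn_leq le_m1.
(* With [S m = 0] the difference is [F m - G m], where both terms represent the same class. *)
rewrite gauge_order1 // S1 // raddf0 subr0.
apply: imdD_exact; last by rewrite raddfB /= DF (usol_closed uG) subr0.
move/eqP/mdeg1P: m1 => [i /eqP ->].
have [_ [x <- xe]] := usol_order1 uF i; have [_ [y <- ye]] := usol_order1 uG i.
have /cls_eq[b db] : cls x = cls y by rewrite xe ye.
by exists b.
Qed.

(** The last step leaves lower orders alone; in order [N.+1] it subtracts d (D c), chosen equal to
    the error. *)
Lemma gauge_approx_correct N m : (mdeg m <= N)%N -> gauge eps (gauge_approx N) F m = G m.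
Proof.
elim: N m => [|N IHN] m le_mN.
  have -> : m = 0%MM by apply/eqP; rewrite -mdeg_eq0 -leqn0.
  have pS := zero_odd_parameter.
  by rewrite (usol_order0 uG) gauge_order0 // (usol_order0 uF).
have pS := gauge_approx_param N; have pS' := gauge_approx_param N.+1.
have eqS I : (mdeg I < mdeg m)%N -> gauge_approx N.+1 I = gauge_approx N I.
  move=> ltI; apply: (gauge_approx_stable (N := N)) => //.
  by rewrite -ltnS; apply: leq_trans ltI le_mN.
have := gauge_local eps (odd_param_order0 pS') (odd_param_order0 pS) (usol_order0 uF) eqS.
have [le_mN'|lt_Nm] := leqP (mdeg m) N.
  by rewrite (gauge_approx_stable le_mN') // => /addIr ->; apply: IHN.
have mN : mdeg m = N.+1 by apply/eqP; rewrite eqn_leq le_mN.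
have [adm|nadm] := boolP (admissible eps m); last first.
  move=> _; rewrite (usol_super uG) //.
  by apply: gauge_super => //; [exact: odd_param_super pS'|exact: usol_super uF].
rewrite (gauge_approx_high lt_Nm) raddf0 addr0 => /(canRL (addrK _)) ->.
rewrite /= /gauge_step mN eqxx adm /=.
set x := gauge eps (gauge_approx N) F m - G m.
have xE : d A (D A (dD_preimage x)) = x.
  rewrite /dD_preimage; apply: (xgetPex 0 (P := [set c | d A (D A c) = x]%classic)).
  apply: gauge_obstruction => //; first by rewrite mN.
    by move=> I ltI; apply: IHN; rewrite -ltnS -mN.
  by move=> _; apply: gauge_approx_high.
have hx : homogeneous (gr A) (mparity eps m) x.
  apply: homogeneousD; last exact: homogeneousN (usol_even uG m).
  exact: (gauge_even (odd_param_odd pS) (odd_parameter_closed pS) (odd_param_order0 pS)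
    (usol_even uF) (usol_closed uF) (odd_param_super pS) (usol_super uF)).
have [_ _ hd _ _ _ _ _] := dgbv_bv_structure A.
have [_ hD _ _ _ _ _ _] := dgbv_bv_structure A.
(* The projection passes through [D] and [d], changing parity twice, and then fixes [x]. *)
rewrite -{1}(negbK (mparity eps m)) -(part_odd _ _ hD) -(part_odd _ _ hd) xE hx.
by rewrite /x subKr.
Qed.

Lemma gauge_equivalent : exists2 S : series n.+1 A, odd_parameter eps S & gauge eps S F = G.
Proof.
(* The diagonal limit: the coefficient at [m] no longer changes after step [mdeg m]. *)
pose S m := gauge_approx (mdeg m) m.
have pS : odd_parameter eps S.
  split=> [m nadm|m|m|]; rewrite /S.
  - exact: odd_param_super (gauge_approx_param _) _ nadm.
  - exact: odd_param_odd (gauge_approx_param _) m.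
  - exact: odd_param_imD (gauge_approx_param _) m.
  - exact: odd_param_order0 (gauge_approx_param _).
exists S => //; apply: funext => m.
have pN := gauge_approx_param (mdeg m).
rewrite -(gauge_approx_correct (leqnn (mdeg m))).
(* [S] and the approximation agree at [m] and below, so [gauge_local] applies with equal correction
   terms. *)
apply: (addIr (d A (S m))); rewrite {2}/S.
apply: gauge_local; [exact: odd_param_order0 pS|exact: odd_param_order0 pN|exact: usol_order0 uF|].
by move=> I ltI; rewrite (@gauge_approx_stable _ (mdeg I)) // ltnW.
Qed.

End Solutions.

(** * The integral as an additive functional *)

Section Integral.
Variables (k : algType rat) (gk : grading k) (A : dgbvAlgebra gk) (I : A -> k^o).
Hypothesis I_integral : integral I.

Lemma integral_zmod_morphism : zmod_morphism I.
Proof.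
have [[f0 [f1 [[f0D _ _] [f1D _ _] fE]]] _ _] := I_integral.
have ID u v : I (u + v) = I u + I v by rewrite !fE f0D f1D addrACA.
by move=> u v; apply: (addIr (I v)); rewrite -ID !subrK.
Qed.

Definition integral_additive : {additive A -> k^o} :=
  HB.pack I (GRing.isZmodMorphism.Build A k^o I integral_zmod_morphism).

(** The rule for moving [d] is applied with second factor 1, and [d 1 = 0] follows from the Leibniz
    rule for 1 * 1. *)
Lemma integral_d x : integral_additive (d A x) = 0.
Proof.
have [_ Id _] := I_integral; have [h1 _ _] := gr_comm A.
have d1 : d A 1 = 0.
  apply: (addrI (d A 1)); rewrite addr0 -[in RHS](mulr1 1) (d_der _ h1).
  by rewrite expr0 !mul1r mulr1.
have hom0 p y : homogeneous (gr A) p y -> integral_additive (d A y) = 0.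
  move=> hy; rewrite -[d A y]mulr1 /= (Id _ _ _ hy) d1 mulr0.
  by rewrite [I 0](raddf0 integral_additive) mulr0.
rewrite -(part_sum (gr A) x) raddfD (raddfD integral_additive).
by rewrite !(hom0 _ _ (homogeneous_part _ _ _)) addr0.
Qed.

Lemma integral_D p x y : homogeneous (gr A) p x ->
  integral_additive (D A x * y) = integral_additive ((-1) ^+ p * (x * D A y)).
Proof.
have [_ _ ID] := I_integral; move=> hx; rewrite [LHS](ID _ _ _ hx) !mulr_sign.
by case: (p); rewrite ?(raddfN integral_additive).
Qed.

End Integral.

Theorem proposition3p3 (k : algType rat) (gk : grading k)
    (k_comm : graded_comm gk) (A : dgbvAlgebra gk) (n : nat)
    (eps : 'I_n.+1 -> bool) (e : 'I_n.+1 -> homology A) (I : A -> k^o)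
    (A_dD : dD_condition A)
    (e_basis : free_basis e)
    (e_parity : forall i, homogeneous_cls (eps i) (e i))
    (e_unit : represents 1 (e ord0))
    (I_integral : integral I) (I_nice : nice I) :
  (forall F G : series n.+1 A,
      universal_solution eps e F -> universal_solution eps e G ->
      exists2 S : series n.+1 A, odd_parameter eps S & gauge eps S F = G) /\
  (forall F S : series n.+1 A,
      universal_solution eps e F -> odd_parameter eps S ->
      potential eps I (gauge eps S F) = potential eps I F).
Proof.
split=> [F G uF uG|F S uF pS]; first exact: (gauge_equivalent A_dD uF uG).
apply: funext => m.
have F_even := usol_even uF; have F_closed := usol_closed uF.
exact: (gauge_potential (I := integral_additive I_integral)
  (odd_param_odd pS) (odd_parameter_closed pS) (odd_param_order0 pS)
  F_even F_closed (usol_order0 uF) (mc_double F_even F_closed (usol_mc uF))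
  (usol_linear uF) (integral_d I_integral) (integral_D I_integral)).
Qed.
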